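(* For any integer $N\ge 2$ and any real $m>0$, $r_0>0$, there exists a family of non-trivial (with $b\neq 0$) periodic solutions of the system $$\ddot r=f(r,d),\quad r(0)=r_0,\ \dot r(0)=0,$$ $$\ddot d=g(r,d),\quad d(0)=0,\ \dot d(0)=b,$$ $$\ddot z=h(r,d,z),\quad z(0)=0,\ \dot z(0)=u,$$ where $f$, $g$, $h$ and the real parameters $a$, $b$, $u$ are as described in the context.
   Context: For an integer $N$, real $m>0$ and a real parameter $a$ (the angular momentum), define for $r>0$ and $d,z\in\mathbb{R}$: $$f(r,d)=\frac{a^2}{r^3}-2rm\sum_{k=1}^{2N-1}\frac{\sin^2(k\pi/2N)}{\left[4r^2\sin^2(k\pi/2N)+((-1)^k-1)^2d^2\right]^{3/2}},$$ $$g(r,d)=-\frac{m\,d}{2}\sum_{k=1}^{2N-1}\frac{((-1)^k-1)^2}{\left[4r^2\sin^2(k\pi/2N)+((-1)^k-1)^2d^2\right]^{3/2}},$$ $$h(r,d,z)=-mN\left[\frac{z-d}{((z-d)^2+r^2)^{3/2}}+\frac{z+d}{((z+d)^2+r^2)^{3/2}}\right].$$ Here $k\pi/2N$ means $k\pi/(2N)$. With $m$, $N$, $r_0$ fixed, the system depends on three real parameters: $a$ (which enters through $f$), and the initial velocities $b=\dot d(0)$ and $u=\dot z(0)$. The functions $r,d$ describe a hip-hop motion of $2N$ primaries of equal mass $m$ at the vertices of an antiprism ($r$ is the distance of each primary to the $z$-axis, $\pm d$ are their heights), and $z$ is the position of a massless body moving on the $z$-axis under the attraction of the primaries. *)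

(* Defs.v *)
From Stdlib Require Import Reals.
From Coquelicot Require Import Coquelicot.
Open Scope R_scope.

Definition hh_angle (N k : nat) : R := INR k * PI / (2 * INR N).

Definition hh_dist2 (N k : nat) (r d : R) : R :=
  4 * r ^ 2 * sin (hh_angle N k) ^ 2 + ((-1) ^ k - 1) ^ 2 * d ^ 2.

(* [Rpower x y] is the real power only for [0 < x]; below, every base is
   positive as soon as [0 < r], since [0 < hh_angle N k < PI] in the range of
   summation. *)
Definition hh_f (N : nat) (m a r d : R) : R :=
  a ^ 2 / r ^ 3
  - 2 * r * m *
    sum_n_m (fun k : nat =>
      sin (hh_angle N k) ^ 2 / Rpower (hh_dist2 N k r d) (3 / 2))
      1 (2 * N - 1).

Definition hh_g (N : nat) (m r d : R) : R :=
  - (m * d / 2) *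
    sum_n_m (fun k : nat =>
      ((-1) ^ k - 1) ^ 2 / Rpower (hh_dist2 N k r d) (3 / 2))
      1 (2 * N - 1).

Definition hh_h (N : nat) (m r d z : R) : R :=
  - (m * INR N) *
    ((z - d) / Rpower ((z - d) ^ 2 + r ^ 2) (3 / 2)
     + (z + d) / Rpower ((z + d) ^ 2 + r ^ 2) (3 / 2)).

(* Existence of [x'] is required separately because [Derive] is total. *)
Definition second_derivative_at (x : R -> R) (t l : R) : Prop :=
  ex_derive x t /\ is_derive (Derive x) t l.

(* Global solution of the initial value problem. Positivity of [r] is part of
   being a solution: the vector field is only defined for [r > 0]. *)
Definition hh_solution (N : nat) (m r0 a b u : R) (r d z : R -> R) : Prop :=
  (forall t : R,
     0 < r t /\
     second_derivative_at r t (hh_f N m a (r t) (d t)) /\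
     second_derivative_at d t (hh_g N m (r t) (d t)) /\
     second_derivative_at z t (hh_h N m (r t) (d t) (z t))) /\
  (r 0 = r0 /\ Derive r 0 = 0) /\
  (d 0 = 0 /\ Derive d 0 = b) /\
  (z 0 = 0 /\ Derive z 0 = u).

(* The three components share the period [T]. *)
Definition hh_periodic (r d z : R -> R) : Prop :=
  exists T : R, 0 < T /\
    forall t : R, r (t + T) = r t /\ d (t + T) = d t /\ z (t + T) = z t.

(* A family is a continuous injective curve [s |-> (a s, b s, u s)] of
   parameters, [0 < s < 1], with a nontrivial periodic solution at each [s].
   By uniqueness the parameters determine the solution. *)
Definition hh_periodic_family (N : nat) (m r0 : R) (a b u : R -> R) : Prop :=
  (forall s : R, 0 < s < 1 ->
     continuous a s /\ continuous b s /\ continuous u s) /\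
  (forall s s' : R, 0 < s < 1 -> 0 < s' < 1 ->
     a s = a s' -> b s = b s' -> u s = u s' -> s = s') /\
  (forall s : R, 0 < s < 1 ->
     b s <> 0 /\
     exists r d z : R -> R,
       hh_solution N m r0 (a s) (b s) (u s) r d z /\ hh_periodic r d z).

(* Main.v *)
(* With u = 0 the massless body stays at z = 0, so only the hip-hop motion (r, d)
   matters. It bifurcates from the circular motion r = r0, d = 0, of squared
   angular momentum A0, in the vertical direction. Write
   r(t) = r0 + x(w t), d(t) = eps y(w t), a^2 = A0 + al and w^-2 = mu0 + mu, where
   mu0 normalises the vertical frequency to 1. The solution is sought with x even,
   y odd and both symmetric about PI/2: the two conditions x'(PI/2) = y'(PI/2) = 0
   are solved by al and mu, the linearised obstruction being sin(k PI/2) <> 0 where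
   k is the ratio of the horizontal to the vertical frequency. Here
   k^2 = 4 (sum 1/s_j) / (sum ((-1)^j - 1)^2 / s_j^3), s_j = sin(j PI / 2N), which
   lies in (0, 4) by concavity of the sine. The remaining equation is a contraction,
   Lipschitz in eps, hence al and mu depend continuously on eps; the curve of
   parameters is injective because b = eps w is increasing for small eps. *)

Require Import Defs.
From Stdlib Require Import Reals Lra Lia Psatz FunctionalExtensionality IndefiniteDescription.
From Coquelicot Require Import Coquelicot.
Open Scope R_scope.

(** * Banach's fixed point theorem for bounded functions *)

(** With [d = eps y] the vertical equation is divided by [eps]: [hh_g] is [d] times a function even
    in [d], so the quotient makes sense at [eps = 0], where [y = sin] and the bifurcation equations
    are nondegenerate. Since [r 0 = r0] is imposed along the whole family, the initial data of [x]
    leave no freedom; this is why the angular momentum has to vary with [eps]. Periodicity is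
    reduced to a quarter period: parity at 0 comes from the initial data, reflection at [PI / 2]
    from the vanishing velocities there, and together they give period [2 PI]. The fixed point
    problem is posed on the forcings of the linearised oscillators rather than on [x] and [y]: each
    forcing determines its response and its multiplier, so both end conditions hold at every step of
    the iteration and only a uniform estimate remains. Strict differentiability is the estimate
    required, because a contraction compares two states near the origin, neither of which is the
    origin. *)

Lemma abs_le (x y : R) : - y <= x <= y -> Rabs x <= y.
Proof. intros H; apply Rabs_le; lra. Qed.

(** Picard iteration with geometric steps. Distances are measured by arbitrary uniform bounds [c]
    instead of a norm, and the free index type [I] lets one function encode a pair of functions on
    [R]. *)
Lemma contraction_fixpoint (I : Type) (K : (I -> R) -> Prop)
  (T : (I -> R) -> I -> R) (u0 : I -> R) (C : R) :
  (forall (un : nat -> I -> R) (u : I -> R), (forall n, K (un n)) ->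
    (forall e, 0 < e -> exists n, forall i, Rabs (un n i - u i) <= e) -> K u) ->
  (forall u, K u -> K (T u)) ->
  (forall u v c, K u -> K v -> (forall i, Rabs (u i - v i) <= c) ->
    forall i, Rabs (T u i - T v i) <= c / 2) ->
  K u0 -> (forall i, Rabs (T u0 i - u0 i) <= C) ->
  exists u, K u /\ forall i, T u i = u i.
Proof.
intros Hcl HT Hc H0 HC.
set (un := fun n => Nat.iter n T u0).
assert (HK : forall n, K (un n)) by (induction n; [exact H0 | now apply HT]).
assert (Hstep : forall n i, Rabs (un (S n) i - un n i) <= C * (/ 2) ^ n).
{ induction n as [|n IH]; intros i.
  - simpl; rewrite Rmult_1_r; apply HC.
  - replace (C * (/ 2) ^ S n) with (C * (/ 2) ^ n / 2) by (simpl; field).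
    exact (Hc _ _ _ (HK (S n)) (HK n) IH i). }
(* The factor [1 - (/ 2) ^ p] makes the telescoped geometric bound inductive in [p]. *)
assert (Hfar : forall n p i, Rabs (un (p + n)%nat i - un n i) <= 2 * C * (/ 2) ^ n * (1 - (/ 2) ^ p)).
{ intros n; induction p as [|p IH]; intros i.
  - simpl; rewrite Rminus_diag, Rabs_R0; lra.
  - replace (un (S p + n)%nat i - un n i)
      with ((un (S (p + n)) i - un (p + n)%nat i) + (un (p + n)%nat i - un n i)) by (simpl; ring).
    eapply Rle_trans; [apply Rabs_triang|].
    specialize (IH i); specialize (Hstep (p + n)%nat i).
    rewrite pow_add in Hstep.
    replace (2 * C * (/ 2) ^ n * (1 - (/ 2) ^ S p))
      with (C * ((/ 2) ^ p * (/ 2) ^ n) + 2 * C * (/ 2) ^ n * (1 - (/ 2) ^ p)) by (simpl; field).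
    lra. }
(* The sign of [C] is known only when [I] is inhabited; hence [Rabs C] in [Hsmall]. *)
assert (HC0 : forall i : I, 0 <= C)
  by (intros i; apply Rle_trans with (2 := HC i), Rabs_pos).
assert (Hhalf : forall p, 0 < (/ 2) ^ p) by (intros p; apply pow_lt; lra).
assert (Hfar' : forall n p i, Rabs (un (p + n)%nat i - un n i) <= 2 * C * (/ 2) ^ n).
{ intros n p i; eapply Rle_trans; [apply Hfar|].
  specialize (Hhalf p); specialize (HC0 i).
  assert (0 <= 2 * C * (/ 2) ^ n) by (apply Rmult_le_pos; [lra | apply pow_le; lra]).
  nra. }
assert (Hsmall : forall e, 0 < e -> exists n, 2 * Rabs C * (/ 2) ^ n <= e).
{ intros e He.
  assert (Hy : 0 < e / (2 * Rabs C + 1)).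
  { apply Rdiv_lt_0_compat; [exact He|]. pose proof (Rabs_pos C); lra. }
  destruct (pow_lt_1_zero (/ 2) ltac:(rewrite Rabs_pos_eq; lra) _ Hy) as [n Hn].
  exists n. specialize (Hn n (le_n n)). rewrite Rabs_pos_eq in Hn by (specialize (Hhalf n); lra).
  pose proof (Rabs_pos C).
  apply Rle_trans with ((2 * Rabs C + 1) * (e / (2 * Rabs C + 1))); [|right; field; lra].
  specialize (Hhalf n).
  apply Rmult_le_compat; lra. }
assert (Hcv : forall i, exists l : R, is_lim_seq (fun n => un n i) l).
{ intros i.
  assert (Hex : ex_finite_lim_seq (fun n => un n i)).
  { apply ex_lim_seq_cauchy_corr. intros e.
    destruct (Hsmall (e / 4) ltac:(destruct e; simpl; lra)) as [n0 Hn0].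
    rewrite (Rabs_pos_eq C (HC0 i)) in Hn0.
    exists n0. intros n p Hn Hp.
    pose proof (Hfar' n0 (n - n0)%nat i) as A. pose proof (Hfar' n0 (p - n0)%nat i) as B.
    replace (n - n0 + n0)%nat with n in A by lia.
    replace (p - n0 + n0)%nat with p in B by lia.
    replace (un n i - un p i) with ((un n i - un n0 i) - (un p i - un n0 i)) by ring.
    apply Rle_lt_trans with (Rabs (un n i - un n0 i) + Rabs (un p i - un n0 i)).
    - unfold Rminus at 1. rewrite <- (Rabs_Ropp (un p i - un n0 i)). apply Rabs_triang.
    - destruct e; simpl in *; lra. }
  destruct Hex as [l Hl]; now exists l. }
destruct (functional_choice _ Hcv) as [u Hu].
assert (Hun : forall n i, Rabs (un n i - u i) <= 2 * C * (/ 2) ^ n).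
{ intros n i.
  assert (Hl : is_lim_seq (fun p => Rabs (un n i - un (p + n)%nat i)) (Rabs (un n i - u i))).
  { apply (is_lim_seq_abs _ (un n i - u i)).
    apply is_lim_seq_minus'; [apply is_lim_seq_const|].
    apply is_lim_seq_incr_n with (u := fun p => un p i). apply Hu. }
  apply (is_lim_seq_le _ (fun _ => 2 * C * (/ 2) ^ n) (Rabs (un n i - u i)) (2 * C * (/ 2) ^ n))
    in Hl; [exact Hl| |apply is_lim_seq_const].
  intros p; rewrite Rabs_minus_sym; apply Hfar'. }
assert (HKu : K u).
{ apply (Hcl un u HK). intros e He. destruct (Hsmall e He) as [n Hn].
  exists n. intros i. eapply Rle_trans; [apply Hun|].
  now rewrite (Rabs_pos_eq C (HC0 i)) in Hn. }
exists u; split; [exact HKu|]. intros i.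
apply Rminus_diag_uniq, Rabs_eq_0, Rle_antisym; [|apply Rabs_pos].
apply le_epsilon. intros e He. destruct (Hsmall (e / 2) ltac:(lra)) as [n Hn].
rewrite (Rabs_pos_eq C (HC0 i)) in Hn.
pose proof (Hc u (un n) (2 * C * (/ 2) ^ n) HKu (HK n)
  ltac:(intros j; rewrite Rabs_minus_sym; apply Hun) i) as A.
pose proof (Hun (S n) i) as B. change (un (S n) i) with (T (un n) i) in B.
replace (T u i - u i) with ((T u i - T (un n) i) + (T (un n) i - u i)) by ring.
eapply Rle_trans; [apply Rabs_triang|].
assert (0 <= 2 * C * (/ 2) ^ n) by (specialize (Hhalf n); specialize (HC0 i); nra).
replace (2 * C * (/ 2) ^ S n) with (2 * C * (/ 2) ^ n / 2) in B by (simpl; field).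
lra.
Qed.

(** * Strict differentiability *)

(** The arguments of the rescaled accelerations at one instant: radial displacement, corrections to
    the squared angular momentum and to [w^-2], and height. Parameters and positions stand on the
    same footing so that one differential covers both. *)
Record state := State { st_x : R; st_al : R; st_mu : R; st_e : R }.

Definition origin : state := State 0 0 0 0.

Definition dst (p q : state) : R :=
  Rabs (st_x p - st_x q) + Rabs (st_al p - st_al q)
  + Rabs (st_mu p - st_mu q) + Rabs (st_e p - st_e q).

Lemma dst_pos (p q : state) : 0 <= dst p q.
Proof.
unfold dst.
pose proof (Rabs_pos (st_x p - st_x q)); pose proof (Rabs_pos (st_al p - st_al q));
pose proof (Rabs_pos (st_mu p - st_mu q)); pose proof (Rabs_pos (st_e p - st_e q)); lra.
Qed.

Lemma dst_refl (p : state) : dst p p = 0.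
Proof. unfold dst; rewrite !Rminus_diag, Rabs_R0; ring. Qed.

(* Strict differentiability at the origin, with differential [L]. *)
Definition sdiff (F L : state -> R) : Prop :=
  (exists C, 0 <= C /\ forall p q, Rabs (L p - L q) <= C * dst p q) /\
  forall eta, 0 < eta -> exists rho, 0 < rho /\ forall p q,
    dst p origin <= rho -> dst q origin <= rho ->
    Rabs ((F p - L p) - (F q - L q)) <= eta * dst p q.

Definition sdiff1 (h : R -> R) (t l : R) : Prop :=
  forall eta, 0 < eta -> exists del, 0 < del /\ forall a b,
    Rabs (a - t) <= del -> Rabs (b - t) <= del ->
    Rabs (h a - h b - l * (a - b)) <= eta * Rabs (a - b).

Lemma sdiff_lip (F L : state -> R) : sdiff F L ->
  exists C rho, 0 < C /\ 0 < rho /\ forall p q,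
    dst p origin <= rho -> dst q origin <= rho -> Rabs (F p - F q) <= C * dst p q.
Proof.
intros [[C [HC HL]] HF]. destruct (HF 1 Rlt_0_1) as [rho [Hr H]].
exists (C + 1), rho. split; [lra|]. split; [exact Hr|]. intros p q Hp Hq.
specialize (H p q Hp Hq). specialize (HL p q).
replace (F p - F q) with (((F p - L p) - (F q - L q)) + (L p - L q)) by ring.
eapply Rle_trans; [apply Rabs_triang|]. lra.
Qed.

Lemma sdiff_ext (F G L M : state -> R) :
  (forall p, F p = G p) -> (forall p, L p = M p) -> sdiff F L -> sdiff G M.
Proof.
intros HF HL H.
replace G with F by (apply functional_extensionality; exact HF).
replace M with L by (apply functional_extensionality; exact HL). exact H.
Qed.

Lemma sdiff_lin (L : state -> R) (c C : R) : 0 <= C ->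
  (forall p q, Rabs (L p - L q) <= C * dst p q) -> sdiff (fun p => c + L p) L.
Proof.
intros HC HL; split; [now exists C|]. intros eta He; exists 1; split; [lra|].
intros p q _ _. replace (c + L p - L p - (c + L q - L q)) with 0 by ring.
rewrite Rabs_R0. apply Rmult_le_pos; [lra | apply dst_pos].
Qed.

Lemma sdiff_const (c : R) : sdiff (fun _ => c) (fun _ => 0).
Proof.
apply (sdiff_ext (fun _ => c + 0) _ (fun _ => 0)); [intros; ring | reflexivity |].
apply (sdiff_lin (fun _ => 0) c 0); [lra|]. intros; rewrite Rminus_diag, Rabs_R0; lra.
Qed.

Lemma sdiff_coord (c : R) :
  sdiff (fun p => c + st_x p) st_x /\ sdiff (fun p => c + st_al p) st_al /\
  sdiff (fun p => c + st_mu p) st_mu /\ sdiff (fun p => c + st_e p) st_e.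
Proof.
repeat split; apply (sdiff_lin _ c 1); try lra; intros p q; rewrite Rmult_1_l; unfold dst;
pose proof (Rabs_pos (st_x p - st_x q)); pose proof (Rabs_pos (st_al p - st_al q));
pose proof (Rabs_pos (st_mu p - st_mu q)); pose proof (Rabs_pos (st_e p - st_e q)); lra.
Qed.

Lemma sdiff_plus (F G L M : state -> R) : sdiff F L -> sdiff G M ->
  sdiff (fun p => F p + G p) (fun p => L p + M p).
Proof.
intros [[C [HC HL]] HF] [[D [HD HM]] HG]. split.
- exists (C + D). split; [lra|]. intros p q. specialize (HL p q); specialize (HM p q).
  replace (L p + M p - (L q + M q)) with ((L p - L q) + (M p - M q)) by ring.
  eapply Rle_trans; [apply Rabs_triang|]. lra.
- intros eta He. destruct (HF (eta / 2) ltac:(lra)) as [r1 [Hr1 H1]].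
  destruct (HG (eta / 2) ltac:(lra)) as [r2 [Hr2 H2]].
  exists (Rmin r1 r2). split; [now apply Rmin_glb_lt|]. intros p q Hp Hq.
  pose proof (Rmin_l r1 r2); pose proof (Rmin_r r1 r2).
  specialize (H1 p q ltac:(lra) ltac:(lra)); specialize (H2 p q ltac:(lra) ltac:(lra)).
  replace (F p + G p - (L p + M p) - (F q + G q - (L q + M q)))
    with ((F p - L p - (F q - L q)) + (G p - M p - (G q - M q))) by ring.
  eapply Rle_trans; [apply Rabs_triang|]. lra.
Qed.

Lemma sdiff_comp (h : R -> R) (l : R) (F L : state -> R) :
  sdiff F L -> sdiff1 h (F origin) l -> sdiff (fun p => h (F p)) (fun p => l * L p).
Proof.
intros HF Hh. destruct (sdiff_lip F L HF) as [C [r0 [HC [Hr0 Hlip]]]].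
destruct HF as [[D [HD HL]] HF]. split.
- exists (Rabs l * D). split; [apply Rmult_le_pos; [apply Rabs_pos | exact HD]|].
  intros p q. rewrite <- Rmult_minus_distr_l, Rabs_mult, Rmult_assoc.
  apply Rmult_le_compat_l; [apply Rabs_pos | apply HL].
- intros eta He.
  destruct (Hh (eta / 2 / C) ltac:(apply Rdiv_lt_0_compat; lra)) as [del [Hdel H1]].
  pose proof (Rabs_pos l) as Hl.
  destruct (HF (eta / 2 / (Rabs l + 1)) ltac:(apply Rdiv_lt_0_compat; lra)) as [r1 [Hr1 H2]].
  exists (Rmin (Rmin r0 r1) (del / C)).
  assert (Hd : 0 < del / C) by (apply Rdiv_lt_0_compat; lra).
  split; [repeat apply Rmin_glb_lt; lra|]. intros p q Hp Hq.
  pose proof (Rmin_l (Rmin r0 r1) (del / C)); pose proof (Rmin_r (Rmin r0 r1) (del / C)).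
  pose proof (Rmin_l r0 r1); pose proof (Rmin_r r0 r1).
  assert (Ho : dst origin origin <= r0) by (rewrite dst_refl; lra).
  assert (near : forall v, dst v origin <= del / C -> dst v origin <= r0 ->
            Rabs (F v - F origin) <= del).
  { intros v Hv Hv'. eapply Rle_trans; [apply (Hlip v origin Hv' Ho)|].
    replace del with (C * (del / C)) at 1 by (field; lra).
    apply Rmult_le_compat_l; lra. }
  specialize (H1 _ _ (near p ltac:(lra) ltac:(lra)) (near q ltac:(lra) ltac:(lra))).
  specialize (H2 p q ltac:(lra) ltac:(lra)).
  specialize (Hlip p q ltac:(lra) ltac:(lra)).
  replace (h (F p) - l * L p - (h (F q) - l * L q))
    with ((h (F p) - h (F q) - l * (F p - F q)) + l * (F p - L p - (F q - L q))) by ring.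
  eapply Rle_trans; [apply Rabs_triang|]. rewrite Rabs_mult.
  pose proof (dst_pos p q) as Hpq.
  assert (A : eta / 2 / C * Rabs (F p - F q) <= eta / 2 * dst p q).
  { apply Rle_trans with (eta / 2 / C * (C * dst p q)); [|right; field; lra].
    apply Rmult_le_compat_l; [|exact Hlip]. left; apply Rdiv_lt_0_compat; lra. }
  assert (B : Rabs l * Rabs (F p - L p - (F q - L q)) <= eta / 2 * dst p q).
  { apply Rle_trans with ((Rabs l + 1) * (eta / 2 / (Rabs l + 1) * dst p q));
      [|right; field; lra].
    apply Rmult_le_compat; [lra | apply Rabs_pos | lra | exact H2]. }
  lra.
Qed.

Lemma sdiff1_sqr (t : R) : sdiff1 (fun s => s ^ 2) t (2 * t).
Proof.
intros eta He. exists (eta / 2). split; [lra|]. intros a b Ha Hb.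
replace (a ^ 2 - b ^ 2 - 2 * t * (a - b)) with (((a - t) + (b - t)) * (a - b)) by ring.
rewrite Rabs_mult. apply Rmult_le_compat_r; [apply Rabs_pos|].
eapply Rle_trans; [apply Rabs_triang|]. lra.
Qed.

Lemma sdiff1_scal (c t : R) : sdiff1 (fun s => c * s) t c.
Proof.
intros eta He. exists 1. split; [lra|]. intros a b _ _.
replace (c * a - c * b - c * (a - b)) with 0 by ring. rewrite Rabs_R0.
apply Rmult_le_pos; [lra | apply Rabs_pos].
Qed.

(** By the mean value theorem the error is [(h1 s - h1 t) * (a - b)] with [s] between [a] and [b],
    which continuity of [h1] at [t] makes small. *)
Lemma sdiff1_derive (h h1 : R -> R) (t r : R) : 0 < r ->
  (forall s, Rabs (s - t) < r -> is_derive h s (h1 s)) -> continuous h1 t ->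
  sdiff1 h t (h1 t).
Proof.
intros Hr Hd Hc eta He.
apply continuity_pt_filterlim in Hc.
destruct (Hc eta He) as [del [Hdel H]].
exists (Rmin del r / 2).
pose proof (Rmin_l del r); pose proof (Rmin_r del r).
assert (0 < Rmin del r) by (apply Rmin_glb_lt; lra).
split; [lra|]. intros a b Ha Hb.
assert (Hab : forall s, Rmin b a <= s <= Rmax b a -> Rabs (s - t) < Rmin del r).
{ intros s Hs. apply Rabs_le_between in Ha; apply Rabs_le_between in Hb.
  apply Rabs_def1; revert Hs; unfold Rmin at 1, Rmax; destruct (Rle_dec b a); lra. }
destruct (MVT_gen h b a h1) as [s [Hs Hmv]].
- intros s Hs. apply Hd. apply Rlt_le_trans with (Rmin del r); [apply Hab; lra | lra].
- intros s Hs. apply continuity_pt_filterlim.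
  apply (ex_derive_continuous h). exists (h1 s). apply Hd.
  apply Rlt_le_trans with (Rmin del r); [apply Hab; lra | lra].
- rewrite Hmv. rewrite <- Rmult_minus_distr_r, Rabs_mult.
  apply Rmult_le_compat_r; [apply Rabs_pos|].
  specialize (Hab s Hs).
  destruct (Req_dec s t) as [->|Hst]; [rewrite Rminus_diag, Rabs_R0; lra|].
  left. apply (H s). split.
  + split; [exact I | intros E; apply Hst; now symmetry].
  + change (Rabs (s - t) < del). lra.
Qed.

Lemma sdiff_scal (c : R) (F L : state -> R) : sdiff F L ->
  sdiff (fun p => c * F p) (fun p => c * L p).
Proof. intros H; apply (sdiff_comp (fun s => c * s) c F L H), sdiff1_scal. Qed.

(* By polarisation, from the square. *)
Lemma sdiff_mult (F G L M : state -> R) : sdiff F L -> sdiff G M ->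
  sdiff (fun p => F p * G p) (fun p => F origin * M p + G origin * L p).
Proof.
intros HF HG.
assert (Hp := sdiff_plus _ _ _ _ HF HG).
assert (Hm := sdiff_plus _ _ _ _ HF (sdiff_scal (-1) _ _ HG)).
assert (Hp2 := sdiff_scal (/ 4) _ _ (sdiff_comp _ _ _ _ Hp (sdiff1_sqr _))).
assert (Hm2 := sdiff_scal (- / 4) _ _ (sdiff_comp _ _ _ _ Hm (sdiff1_sqr _))).
eapply sdiff_ext; [| |exact (sdiff_plus _ _ _ _ Hp2 Hm2)]; intros p; cbv beta; field.
Qed.

Lemma sdiff_sum (F : nat -> state -> R) (l : nat -> R) (n : nat) :
  (forall k, (1 <= k <= n)%nat -> sdiff (F k) (fun p => l k * st_x p)) ->
  sdiff (fun p => sum_n_m (fun k => F k p) 1 n) (fun p => sum_n_m l 1 n * st_x p).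
Proof.
induction n as [|n IH]; intros H.
- apply (sdiff_ext (fun _ => 0) _ (fun _ => 0)); [| |apply sdiff_const];
    intros p; rewrite !sum_n_m_zero by lia; unfold zero; simpl; try ring; reflexivity.
- eapply sdiff_ext; [| |exact (sdiff_plus _ _ _ _ (IH (fun k Hk => H k ltac:(lia)))
    (H (S n) ltac:(lia)))]; intros p; cbv beta; rewrite sum_n_Sm by lia;
    unfold plus; simpl; [reflexivity | ring].
Qed.

(** * Forced harmonic oscillators *)

(** Duhamel's integral of [sin (k * (t - s)) / k * P s] over [s] from 0 to [t], with the sine
    expanded so that [t] enters the integrals only as a bound; [osc1] is its derivative. *)
Definition osc (k : R) (P : R -> R) (t : R) : R :=
  sin (k * t) / k * RInt (fun s => cos (k * s) * P s) 0 t
  - cos (k * t) / k * RInt (fun s => sin (k * s) * P s) 0 t.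

Definition osc1 (k : R) (P : R -> R) (t : R) : R :=
  cos (k * t) * RInt (fun s => cos (k * s) * P s) 0 t
  + sin (k * t) * RInt (fun s => sin (k * s) * P s) 0 t.

Lemma continuous_cos_mult (k : R) (P : R -> R) (t : R) :
  continuous P t -> continuous (fun s => cos (k * s) * P s) t.
Proof.
intros H. apply (continuous_mult (fun s => cos (k * s)) P); [|exact H].
apply (ex_derive_continuous (fun s => cos (k * s))). auto_derive; exact I.
Qed.

Lemma continuous_sin_mult (k : R) (P : R -> R) (t : R) :
  continuous P t -> continuous (fun s => sin (k * s) * P s) t.
Proof.
intros H. apply (continuous_mult (fun s => sin (k * s)) P); [|exact H].
apply (ex_derive_continuous (fun s => sin (k * s))). auto_derive; exact I.
Qed.

Lemma is_derive_primitive (f : R -> R) (t : R) :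
  (forall s, continuous f s) -> is_derive (fun s => RInt f 0 s) t (f t).
Proof.
intros Hf. apply (is_derive_RInt f (fun s => RInt f 0 s) 0 t); [|apply Hf].
apply filter_forall. intros s. apply (@RInt_correct R_CompleteNormedModule).
apply (@ex_RInt_continuous R_CompleteNormedModule). intros; apply Hf.
Qed.

Lemma is_derive_eq (f : R -> R) (t a b : R) : is_derive f t a -> a = b -> is_derive f t b.
Proof. now intros H <-. Qed.

Lemma is_derive_Rext (f g : R -> R) (t a : R) : (forall s : R, f s = g s) ->
  is_derive f t a -> is_derive g t a.
Proof. exact (is_derive_ext f g t a). Qed.

Lemma is_derive_Rplus (f g : R -> R) (t a b : R) : is_derive f t a -> is_derive g t b ->
  is_derive (fun s => f s + g s) t (a + b).
Proof. exact (is_derive_plus f g t a b). Qed.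

Lemma is_derive_Rmult (f g : R -> R) (t a b : R) : is_derive f t a -> is_derive g t b ->
  is_derive (fun s => f s * g s) t (a * g t + f t * b).
Proof. intros Hf Hg; exact (is_derive_mult f g t a b Hf Hg Rmult_comm). Qed.

Lemma is_derive_Rcomp (f g : R -> R) (t a b : R) : is_derive f (g t) a -> is_derive g t b ->
  is_derive (fun s => f (g s)) t (b * a).
Proof. exact (is_derive_comp f g t a b). Qed.

Lemma is_derive_scale (f : R -> R) (c w t a : R) : is_derive f (w * t) a ->
  is_derive (fun s => c * f (w * s)) t (c * w * a).
Proof.
intros H. eapply is_derive_eq.
- apply (is_derive_Rmult (fun _ => c) (fun s => f (w * s)) t 0 (w * a)).
  + apply (is_derive_const c).
  + apply (is_derive_Rcomp f (fun s => w * s)); [exact H|]. auto_derive; [exact I | apply Rmult_1_r].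
- ring.
Qed.

Lemma osc_derive (k : R) (P : R -> R) (t : R) : k <> 0 -> (forall s, continuous P s) ->
  is_derive (osc k P) t (osc1 k P t) /\
  is_derive (osc1 k P) t (- k ^ 2 * osc k P t + P t).
Proof.
intros Hk HP.
assert (HC : is_derive (fun u : R => RInt (fun s : R => cos (k * s) * P s) 0 u) t
                (cos (k * t) * P t))
  by exact (is_derive_primitive _ t (fun s => continuous_cos_mult k P s (HP s))).
assert (HS : is_derive (fun u : R => RInt (fun s : R => sin (k * s) * P s) 0 u) t
                (sin (k * t) * P t))
  by exact (is_derive_primitive _ t (fun s => continuous_sin_mult k P s (HP s))).
assert (Hs : is_derive (fun s => sin (k * s)) t (k * cos (k * t)))
  by (auto_derive; [exact I | ring]).
assert (Hc : is_derive (fun s => cos (k * s)) t (- k * sin (k * t)))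
  by (auto_derive; [exact I | ring]).
assert (Hsk : is_derive (fun s => sin (k * s) / k) t (cos (k * t)))
  by (auto_derive; [exact I | now field]).
assert (Hck : is_derive (fun s => - (cos (k * s) / k)) t (sin (k * t)))
  by (auto_derive; [exact I | now field]).
split.
- eapply is_derive_eq.
  + eapply is_derive_Rext;
      [|exact (is_derive_Rplus _ _ _ _ _
        (is_derive_Rmult _ _ _ _ _ Hsk HC) (is_derive_Rmult _ _ _ _ _ Hck HS))].
    intros s; unfold osc; ring.
  + unfold osc1; cbv beta; field; exact Hk.
- eapply is_derive_eq.
  + exact (is_derive_Rplus _ _ _ _ _
        (is_derive_Rmult _ _ _ _ _ Hc HC) (is_derive_Rmult _ _ _ _ _ Hs HS)).
  + assert (E := sin2_cos2 (k * t)). unfold Rsqr in E.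
    unfold osc; cbv beta.
    replace (P t) with ((sin (k * t) * sin (k * t) + cos (k * t) * cos (k * t)) * P t) at 3
      by (rewrite E; ring).
    field; exact Hk.
Qed.

Lemma osc_0 (k : R) (P : R -> R) : osc k P 0 = 0 /\ osc1 k P 0 = 0.
Proof. unfold osc, osc1; rewrite !RInt_point; unfold zero; simpl; lra. Qed.

Lemma RInt_weight_lip (c P P' : R -> R) (n t : R) :
  (forall s, continuous (fun s => c s * P s) s) -> (forall s, continuous (fun s => c s * P' s) s) ->
  (forall s, Rabs (c s) <= 1) -> (forall s, Rabs (P s - P' s) <= n) -> 0 <= t <= PI / 2 ->
  Rabs (RInt (fun s => c s * P s) 0 t - RInt (fun s => c s * P' s) 0 t) <= 2 * n.
Proof.
intros H H' Hc Hn Ht.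
assert (E : ex_RInt (fun s => c s * P s) 0 t)
  by (apply (@ex_RInt_continuous R_CompleteNormedModule); intros; apply H).
assert (E' : ex_RInt (fun s => c s * P' s) 0 t)
  by (apply (@ex_RInt_continuous R_CompleteNormedModule); intros; apply H').
assert (M := RInt_minus _ _ _ _ E E'). unfold minus, plus, opp in M; simpl in M.
unfold Rminus at 1. rewrite <- M.
assert (0 <= n) by (apply Rle_trans with (2 := Hn 0), Rabs_pos).
apply Rle_trans with ((t - 0) * n).
- apply abs_RInt_le_const; [lra | exact (ex_RInt_minus _ _ _ _ E E') |].
  intros s _. replace (c s * P s + - (c s * P' s)) with (c s * (P s - P' s)) by ring.
  rewrite Rabs_mult. rewrite <- (Rmult_1_l n).
  apply Rmult_le_compat; try apply Rabs_pos; auto.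
(* The length of the interval is at most 2, from the crude bound [PI <= 4]. *)
- apply Rmult_le_compat_r; [assumption|]. pose proof PI_4; lra.
Qed.

Lemma Rabs_cos_le (t : R) : Rabs (cos t) <= 1.
Proof. apply Rabs_le, COS_bound. Qed.

Lemma Rabs_sin_le (t : R) : Rabs (sin t) <= 1.
Proof. apply Rabs_le, SIN_bound. Qed.

Lemma osc_lip (k n t : R) (P P' : R -> R) : 0 < k ->
  (forall s, continuous P s) -> (forall s, continuous P' s) ->
  (forall s, Rabs (P s - P' s) <= n) -> 0 <= t <= PI / 2 ->
  Rabs (osc k P t - osc k P' t) <= 4 / k * n /\
  Rabs (osc1 k P t - osc1 k P' t) <= 4 * n.
Proof.
intros Hk HP HP' Hn Ht.
assert (HC := RInt_weight_lip (fun s => cos (k * s)) P P' n t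
  (fun s => continuous_cos_mult k P s (HP s)) (fun s => continuous_cos_mult k P' s (HP' s))
  (fun s => Rabs_cos_le _) Hn Ht).
assert (HS := RInt_weight_lip (fun s => sin (k * s)) P P' n t
  (fun s => continuous_sin_mult k P s (HP s)) (fun s => continuous_sin_mult k P' s (HP' s))
  (fun s => Rabs_sin_le _) Hn Ht).
unfold osc, osc1; cbv beta in *.
set (A := RInt (fun s => cos (k * s) * P s) 0 t) in *.
set (A' := RInt (fun s => cos (k * s) * P' s) 0 t) in *.
set (B := RInt (fun s => sin (k * s) * P s) 0 t) in *.
set (B' := RInt (fun s => sin (k * s) * P' s) 0 t) in *.
pose proof (Rabs_cos_le (k * t)) as Hc; pose proof (Rabs_sin_le (k * t)) as Hs.
assert (Hmul : forall u v w, Rabs u <= 1 -> Rabs v <= w -> Rabs (u * v) <= w).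
{ intros u v w Hu Hv. rewrite Rabs_mult, <- (Rmult_1_l w).
  apply Rmult_le_compat; try apply Rabs_pos; auto. }
assert (Hk' : 0 < / k) by now apply Rinv_0_lt_compat.
split.
- replace (sin (k * t) / k * A - cos (k * t) / k * B - (sin (k * t) / k * A' - cos (k * t) / k * B'))
    with (/ k * (sin (k * t) * (A - A') + - (cos (k * t) * (B - B')))) by (field; lra).
  rewrite Rabs_mult, (Rabs_pos_eq (/ k)) by lra.
  replace (4 / k * n) with (/ k * (2 * n + 2 * n)) by (field; lra).
  apply Rmult_le_compat_l; [lra|]. eapply Rle_trans; [apply Rabs_triang|].
  rewrite Rabs_Ropp. apply Rplus_le_compat; apply Hmul; auto.
- replace (cos (k * t) * A + sin (k * t) * B - (cos (k * t) * A' + sin (k * t) * B'))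
    with (cos (k * t) * (A - A') + sin (k * t) * (B - B')) by ring.
  eapply Rle_trans; [apply Rabs_triang|]. replace (4 * n) with (2 * n + 2 * n) by ring.
  apply Rplus_le_compat; apply Hmul; auto.
Qed.

(** * Uniqueness and reflection symmetries of oscillators *)

Lemma derive_zero_const (f : R -> R) : (forall t, is_derive f t 0) -> forall t s, f t = f s.
Proof.
intros H t s. destruct (Rtotal_order t s) as [L|[->|L]]; [|reflexivity|].
- apply (eq_is_derive f t s); auto.
- symmetry; apply (eq_is_derive f s t); auto.
Qed.

(** The energy [w1 ^ 2 + k ^ 2 * w ^ 2] is conserved and vanishes at [c]. *)
Lemma harmonic_unique (k c : R) (w w1 : R -> R) : 0 < k ->
  (forall t, is_derive w t (w1 t)) -> (forall t, is_derive w1 t (- k ^ 2 * w t)) ->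
  w c = 0 -> w1 c = 0 -> forall t, w t = 0.
Proof.
intros Hk Hw Hw1 H0 H1 t.
assert (E : (fun s => w1 s * w1 s + k ^ 2 * (w s * w s)) t
          = (fun s => w1 s * w1 s + k ^ 2 * (w s * w s)) c).
{ apply (derive_zero_const (fun s => w1 s * w1 s + k ^ 2 * (w s * w s))). intros s. eapply is_derive_eq.
  - apply (is_derive_Rplus (fun s => w1 s * w1 s) (fun s => k ^ 2 * (w s * w s))).
    + exact (is_derive_Rmult _ _ _ _ _ (Hw1 s) (Hw1 s)).
    + apply (is_derive_Rmult (fun _ => k ^ 2) (fun s => w s * w s) s 0).
      * apply (is_derive_const (k ^ 2)).
      * exact (is_derive_Rmult _ _ _ _ _ (Hw s) (Hw s)).
  - ring. }
cbv beta in E. rewrite H0, H1 in E.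
assert (Hk2 : 0 < k ^ 2) by (apply pow_lt; exact Hk).
apply Rsqr_0_uniq; unfold Rsqr.
apply Rmult_eq_reg_l with (k ^ 2); [|lra].
assert (0 <= k ^ 2 * (w t * w t)) by (apply Rmult_le_pos; [lra | apply Rle_0_sqr]).
pose proof (Rle_0_sqr (w1 t)); unfold Rsqr in *; lra.
Qed.

(** The difference [X (2 * c - t) - sg * X t] solves the unforced equation with zero data at [c]. It
    serves with [c = 0] for parity and with [c = PI / 2], [sg = 1] for the reflection. *)
Lemma harmonic_reflect (k c sg : R) (X X1 F : R -> R) : 0 < k ->
  (forall t, is_derive X t (X1 t)) -> (forall t, is_derive X1 t (- k ^ 2 * X t + F t)) ->
  (forall t, F (2 * c - t) = sg * F t) ->
  X c = sg * X c -> X1 c = - sg * X1 c -> forall t, X (2 * c - t) = sg * X t.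
Proof.
intros Hk HX HX1 HF H0 H1 t. apply Rminus_diag_uniq.
assert (Hr : forall (f : R -> R) s l, is_derive f (2 * c - s) l ->
          is_derive (fun s => f (2 * c - s)) s (- l)).
{ intros f s l H. eapply is_derive_eq.
  - apply (is_derive_Rcomp f (fun s => 2 * c - s)); [exact H|].
    auto_derive; [exact I | reflexivity].
  - ring. }
assert (Hsc : forall (f : R -> R) s l, is_derive f s l ->
          is_derive (fun s => - sg * f s) s (- sg * l)).
{ intros f s l H. exact (is_derive_scal f s (- sg) l H). }
apply (harmonic_unique k c (fun s => X (2 * c - s) - sg * X s)
  (fun s => - X1 (2 * c - s) + - sg * X1 s)); auto.
- intros s. eapply is_derive_Rext; [|eapply is_derive_eq].
  2: exact (is_derive_Rplus _ _ _ _ _ (Hr _ s _ (HX (2 * c - s))) (Hsc _ s _ (HX s))).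
  + intros u; cbv beta; ring.
  + reflexivity.
- intros s. eapply is_derive_eq.
  + apply (is_derive_Rplus (fun s => - X1 (2 * c - s)) (fun s => - sg * X1 s)).
    * apply (is_derive_opp (fun s => X1 (2 * c - s))). exact (Hr _ s _ (HX1 (2 * c - s))).
    * exact (Hsc _ s _ (HX1 s)).
  + unfold opp; simpl. rewrite HF. ring.
- replace (2 * c - c) with c by ring. lra.
- replace (2 * c - c) with c by ring. lra.
Qed.

(** The parity is [sg], equal to 1 or -1 in all uses. Combining both symmetries gives
    [P (t + PI) = sg * P t], hence period [2 PI]. *)
Definition sym (sg : R) (P : R -> R) : Prop :=
  (forall t, continuous P t) /\ (forall t, P (- t) = sg * P t) /\ (forall t, P (PI - t) = P t).

(** The function [Rabs (P t - P' t)] is even and invariant under [t |-> PI - t], hence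
    [PI]-periodic, and [[0, PI / 2]] is a fundamental domain. *)
Lemma sym_bound (sg c : R) (P P' : R -> R) : sg = 1 \/ sg = -1 ->
  (forall t, P (- t) = sg * P t) -> (forall t, P (PI - t) = P t) ->
  (forall t, P' (- t) = sg * P' t) -> (forall t, P' (PI - t) = P' t) ->
  (forall t, 0 <= t <= PI / 2 -> Rabs (P t - P' t) <= c) -> forall t, Rabs (P t - P' t) <= c.
Proof.
intros Hsg He Hr He' Hr' Hc.
set (h := fun t => Rabs (P t - P' t)).
assert (Hhe : forall t, h (- t) = h t).
{ intros t; unfold h; rewrite He, He', <- Rmult_minus_distr_l, Rabs_mult.
  destruct Hsg as [-> | ->]; [rewrite Rabs_R1 | rewrite Rabs_left by lra]; ring. }
assert (Hhr : forall t, h (PI - t) = h t) by (intros t; unfold h; now rewrite Hr, Hr').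
assert (Hper : forall n t, h (t + INR n * PI) = h t).
{ induction n as [|n IH]; intros t; [simpl; f_equal; ring|].
  rewrite S_INR. replace (t + (INR n + 1) * PI) with (PI - - (t + INR n * PI)) by ring.
  now rewrite Hhr, Hhe. }
pose proof PI_RGT_0 as HPI.
assert (Hpos : forall t, 0 <= t -> h t <= c).
{ intros t Ht. destruct (nfloor_ex (t / PI)) as [n Hn].
  { apply Rmult_le_pos; [exact Ht | left; now apply Rinv_0_lt_compat]. }
  assert (Et : t = t / PI * PI) by (field; lra).
  assert (0 <= t - INR n * PI <= PI) by (rewrite Et; nra).
  replace (h t) with (h (t - INR n * PI))
    by (rewrite <- (Hper n (t - INR n * PI)); f_equal; ring).
  destruct (Rle_dec (t - INR n * PI) (PI / 2)); [apply Hc; lra|].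
  rewrite <- Hhr; apply Hc; lra. }
intros t; change (h t <= c). destruct (Rle_dec 0 t); [now apply Hpos|].
rewrite <- Hhe; apply Hpos; lra.
Qed.

(* The forced oscillator [X'' = - k^2 X + P + beta w] at rest at time 0; the
   multiplier [beta P] is chosen so that [X' (PI / 2) = 0], which makes [X]
   inherit the reflection symmetries of [P]. [W] is the response to [w]. *)
Lemma oscillator_solver (k sg CW : R) (w W W1 : R -> R) : 0 < k -> sg = 1 \/ sg = -1 ->
  sym sg w -> (forall t, is_derive W t (W1 t)) ->
  (forall t, is_derive W1 t (- k ^ 2 * W t + w t)) -> W 0 = 0 -> W1 0 = 0 ->
  W1 (PI / 2) <> 0 -> (forall t, 0 <= t <= PI / 2 -> Rabs (W t) <= CW) ->
  exists (X X1 : (R -> R) -> R -> R) (beta : (R -> R) -> R) (C : R), 0 < C /\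
    (forall P, sym sg P ->
      (forall t, is_derive (X P) t (X1 P t)) /\
      (forall t, is_derive (X1 P) t (- k ^ 2 * X P t + P t + beta P * w t)) /\
      X P 0 = 0 /\ X1 P 0 = 0 /\ sym sg (X P)) /\
    (forall P P' n, sym sg P -> sym sg P' -> (forall t, Rabs (P t - P' t) <= n) ->
      Rabs (beta P - beta P') <= C * n /\ forall t, Rabs (X P t - X P' t) <= C * n) /\
    (beta (fun _ => 0) = 0 /\ forall t, X (fun _ => 0) t = 0).
Proof.
intros Hk Hsg Hw HW HW1 HW0 HW10 Hne HCW.
set (beta := fun P => - osc1 k P (PI / 2) / W1 (PI / 2)).
set (X := fun P t => osc k P t + beta P * W t).
set (X1 := fun P t => osc1 k P t + beta P * W1 t).
assert (Hk0 : k <> 0) by lra.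
assert (HX : forall P, (forall t, continuous P t) -> forall t, is_derive (X P) t (X1 P t)).
{ intros P HP t. eapply is_derive_eq.
  - apply (is_derive_Rplus (osc k P) (fun t => beta P * W t)).
    + exact (proj1 (osc_derive k P t Hk0 HP)).
    + exact (is_derive_scal W t (beta P) _ (HW t)).
  - reflexivity. }
assert (HX1 : forall P, (forall t, continuous P t) ->
          forall t, is_derive (X1 P) t (- k ^ 2 * X P t + (P t + beta P * w t))).
{ intros P HP t. eapply is_derive_eq.
  - apply (is_derive_Rplus (osc1 k P) (fun t => beta P * W1 t)).
    + exact (proj2 (osc_derive k P t Hk0 HP)).
    + exact (is_derive_scal W1 t (beta P) _ (HW1 t)).
  - unfold X; ring. }
assert (HX0 : forall P, X P 0 = 0 /\ X1 P 0 = 0).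
{ intros P; unfold X, X1. destruct (osc_0 k P) as [-> ->]. rewrite HW0, HW10; lra. }
assert (Hsym : forall P, sym sg P -> sym sg (X P)).
{ intros P [HP [He Hr]]. destruct Hw as [_ [Hwe Hwr]]. split; [|split].
  - intros t. apply (ex_derive_continuous (X P)). exists (X1 P t). now apply HX.
  - intros t. replace (- t) with (2 * 0 - t) by ring.
    apply (harmonic_reflect k 0 sg (X P) (X1 P) (fun t => P t + beta P * w t)); auto.
    + intros s. replace (2 * 0 - s) with (- s) by ring. rewrite He, Hwe; ring.
    + destruct (HX0 P) as [-> _]; ring.
    + destruct (HX0 P) as [_ ->]; ring.
  - intros t. replace (PI - t) with (2 * (PI / 2) - t) by field.
    rewrite <- (Rmult_1_l (X P t)).
    apply (harmonic_reflect k (PI / 2) 1 (X P) (X1 P) (fun t => P t + beta P * w t)); auto.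
    + intros s. replace (2 * (PI / 2) - s) with (PI - s) by field. rewrite Hr, Hwr; ring.
    + ring.
    + assert (X1 P (PI / 2) = 0) as -> by (unfold X1, beta; now field). ring. }
pose proof PI_RGT_0 as HPI.
assert (HCW0 : 0 <= CW) by (apply Rle_trans with (2 := HCW 0 ltac:(lra)), Rabs_pos).
assert (Hw1 : 0 < Rabs (W1 (PI / 2))) by now apply Rabs_pos_lt.
set (D := 4 / Rabs (W1 (PI / 2))).
assert (HD : 0 < D) by (apply Rdiv_lt_0_compat; lra).
assert (H4k : 0 < 4 / k) by (apply Rdiv_lt_0_compat; lra).
exists X, X1, beta, (D + 4 / k + D * CW).
assert (HDC : 0 <= D * CW) by (apply Rmult_le_pos; lra).
split; [lra|]. split; [|split].
- intros P HP. destruct (HX0 P) as [H0 H10].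
  split; [exact (HX P (proj1 HP))|]. split; [|now split; [|split; [|apply Hsym]]].
  intros t; eapply is_derive_eq; [exact (HX1 P (proj1 HP) t) | ring].
- intros P P' n HP HP' Hn.
  assert (Hn0 : 0 <= n) by (apply Rle_trans with (2 := Hn 0), Rabs_pos).
  assert (Hb : Rabs (beta P - beta P') <= D * n).
  { unfold beta.
    replace (- osc1 k P (PI / 2) / W1 (PI / 2) - - osc1 k P' (PI / 2) / W1 (PI / 2))
      with (- ((osc1 k P (PI / 2) - osc1 k P' (PI / 2)) / W1 (PI / 2))) by (now field).
    rewrite Rabs_Ropp. unfold Rdiv at 1. rewrite Rabs_mult, Rabs_inv.
    replace (D * n) with (4 * n * / Rabs (W1 (PI / 2))) by (unfold D; field; lra).
    apply Rmult_le_compat_r; [left; now apply Rinv_0_lt_compat|].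
    apply (osc_lip k n (PI / 2) P P'); [lra | apply HP | apply HP' | exact Hn | lra]. }
  split; [nra|].
  destruct (Hsym P HP) as [_ [He Hr]]; destruct (Hsym P' HP') as [_ [He' Hr']].
  (* Working on the quarter period is essential: [W] may grow without bound on [R], as it does in
     the resonant case, and only the combination [X P] has the symmetries. *)
  apply (sym_bound sg); auto. intros t Ht.
  unfold X.
  replace (osc k P t + beta P * W t - (osc k P' t + beta P' * W t))
    with ((osc k P t - osc k P' t) + (beta P - beta P') * W t) by ring.
  eapply Rle_trans; [apply Rabs_triang|]. rewrite Rabs_mult.
  assert (A : Rabs (osc k P t - osc k P' t) <= 4 / k * n)
    by (apply osc_lip; [lra | apply HP | apply HP' | exact Hn | lra]).
  assert (B : Rabs (beta P - beta P') * Rabs (W t) <= D * n * CW)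
    by (apply Rmult_le_compat; try apply Rabs_pos; auto).
  nra.
- assert (HR : forall (c : R -> R) t, RInt (fun s => c s * 0) 0 t = 0).
  { intros c t. rewrite (RInt_ext _ (fun _ => 0)) by (intros s _; apply Rmult_0_r).
    rewrite RInt_const. unfold scal; simpl; unfold mult; simpl; ring. }
  assert (Hb : beta (fun _ => 0) = 0).
  { unfold beta, osc1. rewrite !HR. now field. }
  split; [exact Hb|]. intros t. unfold X. rewrite Hb. unfold osc. rewrite !HR. ring.
Qed.

(** * Bifurcation of symmetric periodic solutions *)

(** Iterating [n |-> n / 2 + c] from any starting bound tends to its fixed point [2 * c]. It turns
    the contraction estimate into a Lipschitz dependence of fixed points on a parameter. *)
Lemma halving_bound (I : Type) (d : I -> R) (n0 c : R) : 0 <= c ->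
  (forall n, (forall i, Rabs (d i) <= n) -> forall i, Rabs (d i) <= n / 2 + c) ->
  (forall i, Rabs (d i) <= n0) -> forall i, Rabs (d i) <= 2 * c.
Proof.
intros Hc H H0 i.
assert (Hk : forall k j, Rabs (d j) <= 2 * c + Rabs n0 * (/ 2) ^ k).
{ induction k as [|k IH]; intros j.
  - simpl. pose proof (Rle_abs n0). specialize (H0 j). lra.
  - specialize (H _ IH j). simpl. lra. }
apply le_epsilon. intros e He.
pose proof (Rabs_pos n0) as Hn0.
destruct (pow_lt_1_zero (/ 2) ltac:(rewrite Rabs_pos_eq; lra) (e / (Rabs n0 + 1))
  ltac:(apply Rdiv_lt_0_compat; lra)) as [k Hk'].
specialize (Hk' k (le_n k)). rewrite Rabs_pos_eq in Hk' by (apply pow_le; lra).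
eapply Rle_trans; [apply (Hk k)|]. apply Rplus_le_compat_l.
apply Rle_trans with ((Rabs n0 + 1) * (e / (Rabs n0 + 1))); [|right; field; lra].
apply Rmult_le_compat; [lra | apply pow_le; lra | lra | lra].
Qed.

Lemma continuous_eps (f : R -> R) (t : R) :
  (forall e, 0 < e -> exists del, 0 < del /\ forall s, Rabs (s - t) < del -> Rabs (f s - f t) <= e) ->
  continuous f t.
Proof.
intros H. apply filterlim_locally. intros [e He].
destruct (H (e / 2) ltac:(lra)) as [del [Hd Hs]].
exists (mkposreal del Hd). intros s Hst.
apply Rle_lt_trans with (e / 2); [|simpl; lra]. apply Hs, Hst.
Qed.

Lemma continuous_eps_inv (f : R -> R) (t e : R) : continuous f t -> 0 < e ->
  exists del, 0 < del /\ forall s, Rabs (s - t) < del -> Rabs (f s - f t) < e.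
Proof.
intros H He. apply filterlim_locally with (eps := mkposreal e He) in H.
destruct H as [[del Hd] H]. exists del. split; [exact Hd|]. intros s Hs. apply (H s Hs).
Qed.

Lemma continuous_uniform_limit (fn : nat -> R -> R) (f : R -> R) :
  (forall n t, continuous (fn n) t) ->
  (forall e, 0 < e -> exists n, forall t, Rabs (fn n t - f t) <= e) -> forall t, continuous f t.
Proof.
intros Hn Hu t. apply continuous_eps. intros e He.
destruct (Hu (e / 3) ltac:(lra)) as [n H].
destruct (continuous_eps_inv _ t (e / 3) (Hn n t) ltac:(lra)) as [del [Hd Hs]].
exists del; split; [exact Hd|]. intros s Hst. specialize (Hs s Hst).
pose proof (H s) as A. pose proof (H t) as B.
apply Rabs_le_between in A; apply Rabs_le_between in B; apply Rabs_def2 in Hs.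
apply abs_le; lra.
Qed.

Lemma uniform_limit_eq (I : Type) (un : nat -> I -> R) (u : I -> R) (i j : I) (sg : R) :
  (forall e, 0 < e -> exists n, forall i, Rabs (un n i - u i) <= e) -> Rabs sg <= 1 ->
  (forall n, un n i = sg * un n j) -> u i = sg * u j.
Proof.
intros Hu Hsg He. apply Rminus_diag_uniq, Rabs_eq_0, Rle_antisym; [|apply Rabs_pos].
apply le_epsilon. intros e Hee. destruct (Hu (e / 2) ltac:(lra)) as [n Hn].
replace (u i - sg * u j) with (sg * (un n j - u j) - (un n i - u i)) by (rewrite He; ring).
pose proof (Hn i) as A. pose proof (Hn j) as B.
assert (D : Rabs (sg * (un n j - u j)) <= e / 2).
{ rewrite Rabs_mult, <- (Rmult_1_l (e / 2)). apply Rmult_le_compat; auto; apply Rabs_pos. }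
apply Rabs_le_between in A; apply Rabs_le_between in D. apply abs_le; lra.
Qed.

Lemma sym_uniform_limit (sg : R) (fn : nat -> R -> R) (f : R -> R) : Rabs sg <= 1 ->
  (forall n, sym sg (fn n)) ->
  (forall e, 0 < e -> exists n, forall t, Rabs (fn n t - f t) <= e) -> sym sg f.
Proof.
intros Hsg Hn Hu. split; [|split].
- apply (continuous_uniform_limit fn); [intros n; apply Hn | exact Hu].
- intros t. apply (uniform_limit_eq R fn f); auto. intros n; apply Hn.
- intros t. rewrite <- (Rmult_1_l (f t)). apply (uniform_limit_eq R fn f); auto.
  + rewrite Rabs_R1; lra.
  + intros n. rewrite Rmult_1_l. apply Hn.
Qed.

Lemma continuous_curve (F : state -> R) (C rho : R) (g : R -> state) : 0 < C ->
  (forall p q, dst p origin <= rho -> dst q origin <= rho -> Rabs (F p - F q) <= C * dst p q) ->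
  (forall t, dst (g t) origin <= rho) ->
  (forall t, continuous (fun s => st_x (g s)) t) -> (forall t, continuous (fun s => st_al (g s)) t) ->
  (forall t, continuous (fun s => st_mu (g s)) t) -> (forall t, continuous (fun s => st_e (g s)) t) ->
  forall t, continuous (fun s => F (g s)) t.
Proof.
intros HC HF Hg H1 H2 H3 H4 t. apply continuous_eps. intros e He.
assert (Hd : 0 < e / (4 * C)) by (apply Rdiv_lt_0_compat; lra).
destruct (continuous_eps_inv _ t _ (H1 t) Hd) as [d1 [Hd1 K1]].
destruct (continuous_eps_inv _ t _ (H2 t) Hd) as [d2 [Hd2 K2]].
destruct (continuous_eps_inv _ t _ (H3 t) Hd) as [d3 [Hd3 K3]].
destruct (continuous_eps_inv _ t _ (H4 t) Hd) as [d4 [Hd4 K4]].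
exists (Rmin (Rmin d1 d2) (Rmin d3 d4)). split; [repeat apply Rmin_glb_lt; lra|].
intros s Hs.
pose proof (Rmin_l (Rmin d1 d2) (Rmin d3 d4)); pose proof (Rmin_r (Rmin d1 d2) (Rmin d3 d4)).
pose proof (Rmin_l d1 d2); pose proof (Rmin_r d1 d2).
pose proof (Rmin_l d3 d4); pose proof (Rmin_r d3 d4).
specialize (K1 s ltac:(lra)); specialize (K2 s ltac:(lra)).
specialize (K3 s ltac:(lra)); specialize (K4 s ltac:(lra)).
eapply Rle_trans; [apply HF; apply Hg|].
replace e with (C * (4 * (e / (4 * C)))) by (field; lra).
apply Rmult_le_compat_l; [lra|]. unfold dst. cbv beta in *. lra.
Qed.

Lemma sym_scal (sg c : R) (P : R -> R) : sym sg P -> sym sg (fun t => c * P t).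
Proof.
intros [HP [He Hr]]. split; [|split].
- intros t. apply (continuous_mult (fun _ => c) P); [apply continuous_const | apply HP].
- intros t; rewrite He; ring.
- intros t; now rewrite Hr.
Qed.

Lemma sym_sin : sym (-1) sin.
Proof.
split; [|split].
- intros t. apply (ex_derive_continuous sin). auto_derive; exact I.
- intros t; rewrite sin_neg; ring.
- intros t. apply sin_PI_x.
Qed.

Lemma sym_const (c : R) : sym 1 (fun _ => c).
Proof. split; [|split]; intros; try ring. apply continuous_const. Qed.

Lemma Rabs_sum_le (a b c d : R) : Rabs a <= c -> Rabs b <= d -> Rabs (a + b) <= c + d.
Proof. intros; eapply Rle_trans; [apply Rabs_triang|]; lra. Qed.

Lemma Rabs_prod_le (a b c d : R) : Rabs a <= c -> Rabs b <= d -> Rabs (a * b) <= c * d.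
Proof. intros; rewrite Rabs_mult; apply Rmult_le_compat; auto; apply Rabs_pos. Qed.

(** The resonant oscillator: its response to [sin] has the secular term [t * cos t], but its
    velocity at [PI / 2] is [PI / 4], so a multiple of [sin] can cancel any velocity there. *)
Lemma sin_solver : exists (X X1 : (R -> R) -> R -> R) (beta : (R -> R) -> R) (C : R), 0 < C /\
    (forall P, sym (-1) P ->
      (forall t, is_derive (X P) t (X1 P t)) /\
      (forall t, is_derive (X1 P) t (- 1 ^ 2 * X P t + P t + beta P * sin t)) /\
      X P 0 = 0 /\ X1 P 0 = 0 /\ sym (-1) (X P)) /\
    (forall P P' n, sym (-1) P -> sym (-1) P' -> (forall t, Rabs (P t - P' t) <= n) ->
      Rabs (beta P - beta P') <= C * n /\ forall t, Rabs (X P t - X P' t) <= C * n) /\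
    (beta (fun _ => 0) = 0 /\ forall t, X (fun _ => 0) t = 0).
Proof.
apply (oscillator_solver 1 (-1) 2 sin (fun t => (sin t - t * cos t) / 2) (fun t => t * sin t / 2));
  try lra.
- apply sym_sin.
- intros t; auto_derive; [exact I | field].
- intros t; auto_derive; [exact I | field].
- rewrite sin_0; lra.
- rewrite sin_PI2. pose proof PI_RGT_0; lra.
- intros t Ht. pose proof PI_4.
  replace ((sin t - t * cos t) / 2) with (/ 2 * (sin t + - t * cos t)) by field.
  apply Rle_trans with (/ 2 * (1 + 2 * 1)); [|lra].
  apply Rabs_prod_le; [rewrite Rabs_pos_eq; lra|].
  apply Rabs_sum_le; [apply Rabs_sin_le|].
  apply Rabs_prod_le; [apply abs_le; lra | apply Rabs_cos_le].
Qed.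

(** The response to a constant has velocity [sin (k * (PI / 2)) / k] at [PI / 2], which is positive
    because [k < 2] puts the argument inside [(0, PI)]. *)
Lemma const_solver (k : R) : 0 < k < 2 ->
  exists (X X1 : (R -> R) -> R -> R) (beta : (R -> R) -> R) (C : R), 0 < C /\
    (forall P, sym 1 P ->
      (forall t, is_derive (X P) t (X1 P t)) /\
      (forall t, is_derive (X1 P) t (- k ^ 2 * X P t + P t + beta P * 1)) /\
      X P 0 = 0 /\ X1 P 0 = 0 /\ sym 1 (X P)) /\
    (forall P P' n, sym 1 P -> sym 1 P' -> (forall t, Rabs (P t - P' t) <= n) ->
      Rabs (beta P - beta P') <= C * n /\ forall t, Rabs (X P t - X P' t) <= C * n) /\
    (beta (fun _ => 0) = 0 /\ forall t, X (fun _ => 0) t = 0).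
Proof.
intros Hk.
apply (oscillator_solver k 1 (2 / k ^ 2) (fun _ => 1) (fun t => (1 - cos (k * t)) / k ^ 2)
  (fun t => sin (k * t) / k)); try lra.
- apply sym_const.
- intros t; auto_derive; [exact I | field; lra].
- intros t; auto_derive; [exact I | field; lra].
- rewrite Rmult_0_r, cos_0. field; lra.
- rewrite Rmult_0_r, sin_0. field; lra.
- pose proof PI_RGT_0. assert (0 < sin (k * (PI / 2))) by (apply sin_gt_0; nra).
  apply Rgt_not_eq. now apply Rdiv_lt_0_compat.
- intros t _. assert (0 < k ^ 2) by (apply pow_lt; lra).
  unfold Rdiv. apply Rabs_prod_le.
  + pose proof (COS_bound (k * t)); apply abs_le; lra.
  + rewrite Rabs_pos_eq; [lra|]. left; now apply Rinv_0_lt_compat.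
Qed.

(* To be used with [G = 1 + Fy], which is small, and [A = G + Om0 mu], whose
   variation is close to that of [l x]. *)
Lemma forcing_difference (A A' G G' y y' s a g b h c : R) :
  Rabs s <= 1 -> Rabs (A - A') <= a -> Rabs (G - G') <= g -> Rabs y <= b ->
  Rabs G' <= h -> Rabs (y - y') <= c ->
  Rabs ((A * s + G * y) - (A' * s + G' * y')) <= a + g * b + h * c.
Proof.
intros. replace ((A * s + G * y) - (A' * s + G' * y'))
  with ((A - A') * s + (G - G') * y + G' * (y - y')) by ring.
replace a with (a * 1) by ring.
repeat apply Rabs_sum_le; apply Rabs_prod_le; auto.
Qed.

(* A Lyapunov centre theorem for [x'' = Fx], [y'' = Fy y] with [e = eps y],
   both reversible; the unknowns of the contraction are the forcings of the
   linearised oscillators, the second one divided by a large constant [Lam]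
   that makes the triangular coupling [l x] small. *)
Lemma reversible_center (k c0 Om0 l rho0 : R) (Fx Fy : state -> R) :
  0 < k < 2 -> c0 <> 0 -> Om0 <> 0 -> 0 < rho0 ->
  sdiff Fx (fun p => - k ^ 2 * st_x p + c0 * st_al p) ->
  sdiff Fy (fun p => l * st_x p - Om0 * st_mu p) ->
  Fx origin = 0 -> Fy origin = -1 ->
  (forall x al mu e, Fx (State x al mu (- e)) = Fx (State x al mu e)) ->
  (forall x al mu e, Fy (State x al mu (- e)) = Fy (State x al mu e)) ->
  exists (e0 L : R) (al mu : R -> R) (x x1 y y1 : R -> R -> R), 0 < e0 /\
  (forall eps, 0 <= eps <= e0 ->
    Rabs (al eps) <= rho0 /\ Rabs (mu eps) <= rho0 /\ (forall t, Rabs (x eps t) <= rho0) /\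
    (x eps 0 = 0 /\ x1 eps 0 = 0) /\ (y eps 0 = 0 /\ y1 eps 0 = 1) /\
    (forall t, is_derive (x eps) t (x1 eps t)) /\
    (forall t, is_derive (x1 eps) t (Fx (State (x eps t) (al eps) (mu eps) (eps * y eps t)))) /\
    (forall t, is_derive (y eps) t (y1 eps t)) /\
    (forall t, is_derive (y1 eps) t
       (Fy (State (x eps t) (al eps) (mu eps) (eps * y eps t)) * y eps t)) /\
    (forall t, x eps (t + 2 * PI) = x eps t) /\ (forall t, y eps (t + 2 * PI) = y eps t)) /\
  (forall eps eps', 0 <= eps <= e0 -> 0 <= eps' <= e0 ->
    Rabs (al eps - al eps') <= L * Rabs (eps - eps') /\
    Rabs (mu eps - mu eps') <= L * Rabs (eps - eps')).
Proof.
intros Hk Hc0 HOm Hrho0 HFx HFy HFx0 HFy0 HFxe HFye.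
destruct (const_solver k Hk) as (X & X1 & ba & Ca & HCa & HX & HXl & Hba0 & HX0).
destruct sin_solver as (Y & Y1 & bb & Cb & HCb & HY & HYl & Hbb0 & HY0).
destruct (sdiff_lip _ _ HFx) as (K0 & rx & HK0 & Hrx & HFxl).
destruct (sdiff_lip _ _ HFy) as (K1 & ry & HK1 & Hry & HFyl).
set (C := Ca + Cb).
(* The 8 brings the coupling term [Rabs l * C / Lam] below [1 / 8]. [C] is fixed before [Lam]; [B]
   grows with [Lam], which [eta] and [R0], chosen later, compensate. *)
set (Lam := 1 + 8 * (Rabs l * C)).
pose proof (Rabs_pos l) as Hl.
assert (HC : 0 < C) by (unfold C; lra).
assert (HlC : 0 <= Rabs l * C) by (apply Rmult_le_pos; lra).
assert (HLam : 1 <= Lam) by (unfold Lam; lra).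
assert (Hic : 0 < / Rabs c0) by now apply Rinv_0_lt_compat, Rabs_pos_lt.
assert (Hio : 0 < / Rabs Om0) by now apply Rinv_0_lt_compat, Rabs_pos_lt.
assert (HCL : 0 < C * Lam) by (apply Rmult_lt_0_compat; lra).
(* A common Lipschitz constant in [u] for the responses [X], [Y] and for both parameters. *)
set (B := 1 + C + C * / Rabs c0 + C * Lam + C * Lam * / Rabs Om0).
assert (HB1 : 0 < C * / Rabs c0) by now apply Rmult_lt_0_compat.
assert (HB2 : 0 < C * Lam * / Rabs Om0) by now apply Rmult_lt_0_compat.
assert (HB : 1 <= B) by (unfold B; lra).
(* In the vertical component the factor [1 / 2] is spent as four eighths: the remainder of strict
   differentiability, the variation of [1 + Fy] against [Y], [1 + Fy] against the variation of [Y],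
   and the coupling [l]. Here 32 is 8 times the four coordinates in [dst]. *)
set (eta := / (32 * B)).
assert (Heta : 0 < eta) by (apply Rinv_0_lt_compat; lra).
assert (HetaB : eta * (4 * B) = / 8) by (unfold eta; field; lra).
destruct (proj2 HFx eta Heta) as (rx' & Hrx' & HFxs).
destruct (proj2 HFy eta Heta) as (ry' & Hry' & HFys).
set (rho := Rmin rho0 (Rmin (Rmin rx ry) (Rmin rx' ry'))).
assert (Hrho : 0 < rho) by (repeat apply Rmin_glb_lt; assumption).
assert (Hr : rho <= rho0 /\ rho <= rx /\ rho <= ry /\ rho <= rx' /\ rho <= ry').
{ unfold rho.
  pose proof (Rmin_l rho0 (Rmin (Rmin rx ry) (Rmin rx' ry')));
  pose proof (Rmin_r rho0 (Rmin (Rmin rx ry) (Rmin rx' ry')));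
  pose proof (Rmin_l (Rmin rx ry) (Rmin rx' ry'));
  pose proof (Rmin_r (Rmin rx ry) (Rmin rx' ry'));
  pose proof (Rmin_l rx ry); pose proof (Rmin_r rx ry);
  pose proof (Rmin_l rx' ry'); pose proof (Rmin_r rx' ry'); lra. }
destruct Hr as (Hr0 & Hr1 & Hr2 & Hr3 & Hr4).
(* The three bounds make [Y] at most 1, keep all states within [rho] of the origin, and make the two
   products involving [1 + Fy] fit into an eighth each. *)
set (R0 := Rmin (/ B) (Rmin (rho / (4 * B)) (/ (32 * K1 * B * B)))).
assert (HKB : 0 < 32 * K1 * B * B) by (repeat apply Rmult_lt_0_compat; lra).
assert (HR0 : 0 < R0).
{ unfold R0; repeat apply Rmin_glb_lt;
    [apply Rinv_0_lt_compat; lra | apply Rdiv_lt_0_compat; lra | now apply Rinv_0_lt_compat]. }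
assert (HBR : B * R0 <= 1 /\ 4 * (B * R0) <= rho /\ K1 * (4 * (B * R0)) * B <= / 8).
{ pose proof (Rmin_l (/ B) (Rmin (rho / (4 * B)) (/ (32 * K1 * B * B)))) as A1.
  pose proof (Rmin_r (/ B) (Rmin (rho / (4 * B)) (/ (32 * K1 * B * B)))) as A2.
  pose proof (Rmin_l (rho / (4 * B)) (/ (32 * K1 * B * B))) as A3.
  pose proof (Rmin_r (rho / (4 * B)) (/ (32 * K1 * B * B))) as A4.
  fold R0 in A1, A2.
  repeat split.
  - replace 1 with (B * / B) by (field; lra). apply Rmult_le_compat_l; lra.
  - replace rho with (4 * (B * (rho / (4 * B)))) by (field; lra).
    apply Rmult_le_compat_l; [lra|]. apply Rmult_le_compat_l; lra.
  - replace (/ 8) with (4 * K1 * B * B * / (32 * K1 * B * B)) by (field; lra).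
    replace (K1 * (4 * (B * R0)) * B) with (4 * K1 * B * B * R0) by ring.
    apply Rmult_le_compat_l; [|lra]. repeat apply Rmult_le_pos; lra. }
destruct HBR as (HBR1 & HBR2 & HBR3).
set (L0 := 1 + 2 * K1).
(* As [y] is at most 2, [2 * e0 <= B * R0] bounds the height; [L0 * e0 <= R0 / 2] lets the iteration
   preserve the ball of radius [R0]. *)
set (e0 := Rmin 1 (Rmin (B * R0 / 2) (R0 / (2 * L0)))).
assert (HBR : 0 < B * R0) by (apply Rmult_lt_0_compat; lra).
assert (HL0 : 1 <= L0) by (unfold L0; lra).
assert (He0 : 0 < e0).
{ unfold e0; repeat apply Rmin_glb_lt; try lra; apply Rdiv_lt_0_compat; lra. }
assert (He : e0 <= 1 /\ 2 * e0 <= B * R0 /\ L0 * e0 <= R0 / 2).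
{ pose proof (Rmin_l 1 (Rmin (B * R0 / 2) (R0 / (2 * L0)))) as A1.
  pose proof (Rmin_r 1 (Rmin (B * R0 / 2) (R0 / (2 * L0)))) as A2.
  pose proof (Rmin_l (B * R0 / 2) (R0 / (2 * L0))) as A3.
  pose proof (Rmin_r (B * R0 / 2) (R0 / (2 * L0))) as A4.
  fold e0 in A1, A2. repeat split; try lra.
  replace (R0 / 2) with (L0 * (R0 / (2 * L0))) by (field; lra).
  apply Rmult_le_compat_l; lra. }
destruct He as (He1 & He2 & He3).
set (idx := (bool * R)%type).
set (P := fun (u : idx -> R) t => u (true, t)).
set (Q := fun (u : idx -> R) t => Lam * u (false, t)).
set (alp := fun u => ba (P u) / c0).
set (muu := fun u => - bb (Q u) / Om0).
set (st := fun eps u t => State (X (P u) t) (alp u) (muu u) (eps * (sin t + Y (Q u) t))).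
(* Each component is what the equation of motion leaves once the linear oscillator and its
   multiplier are subtracted, so a fixed point solves the equations exactly. In the vertical one,
   [Om0 * muu u * sin t] cancels the first-order effect of [mu]. *)
set (T := fun eps u (i : idx) => let (b, t) := i in
  if b then Fx (st eps u t) + k ^ 2 * X (P u) t - c0 * alp u
  else ((1 + Fy (st eps u t)) * (sin t + Y (Q u) t) + Om0 * muu u * sin t) / Lam).
set (K := fun u : idx -> R => sym 1 (P u) /\ sym (-1) (fun t => u (false, t)) /\
  forall i, Rabs (u i) <= R0).
assert (HQ : forall u, K u -> sym (-1) (Q u)) by (intros u Hu; apply sym_scal, Hu).
assert (Hlin : forall u v n, sym 1 (P u) -> sym 1 (P v) -> sym (-1) (Q u) -> sym (-1) (Q v) ->
  (forall i, Rabs (u i - v i) <= n) ->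
  Rabs (alp u - alp v) <= B * n /\ Rabs (muu u - muu v) <= B * n /\
  forall t, Rabs (X (P u) t - X (P v) t) <= C * n /\ Rabs (X (P u) t - X (P v) t) <= B * n /\
    Rabs (Y (Q u) t - Y (Q v) t) <= B * n).
{ intros u v n HPu HPv HQu HQv Hn.
  assert (Hn0 : 0 <= n) by (apply Rle_trans with (2 := Hn (true, 0)), Rabs_pos).
  destruct (HXl (P u) (P v) n HPu HPv (fun t => Hn (true, t))) as [A1 A2].
  assert (HnQ : forall t, Rabs (Q u t - Q v t) <= Lam * n).
  { intros t; unfold Q. rewrite <- Rmult_minus_distr_l, Rabs_mult, (Rabs_pos_eq Lam) by lra.
    apply Rmult_le_compat_l; [lra | apply Hn]. }
  destruct (HYl (Q u) (Q v) (Lam * n) HQu HQv HnQ) as [B1 B2].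
  assert (HCan : Ca * n <= C * n) by (apply Rmult_le_compat_r; unfold C; lra).
  assert (HCbn : Cb * (Lam * n) <= C * Lam * n).
  { rewrite Rmult_assoc. apply Rmult_le_compat_r; [|unfold C; lra]. apply Rmult_le_pos; lra. }
  assert (Hmono : forall z, 0 <= z <= B -> z * n <= B * n)
    by (intros; apply Rmult_le_compat_r; lra).
  split; [|split].
  - unfold alp. replace (ba (P u) / c0 - ba (P v) / c0) with ((ba (P u) - ba (P v)) * / c0)
      by (field; auto).
    rewrite Rabs_mult, Rabs_inv.
    apply Rle_trans with (C * / Rabs c0 * n); [|apply Hmono; unfold B; lra].
    replace (C * / Rabs c0 * n) with (C * n * / Rabs c0) by ring.
    apply Rmult_le_compat_r; lra.
  - unfold muu. replace (- bb (Q u) / Om0 - - bb (Q v) / Om0)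
      with (- ((bb (Q u) - bb (Q v)) * / Om0)) by (field; auto).
    rewrite Rabs_Ropp, Rabs_mult, Rabs_inv.
    apply Rle_trans with (C * Lam * / Rabs Om0 * n); [|apply Hmono; unfold B; lra].
    replace (C * Lam * / Rabs Om0 * n) with (C * Lam * n * / Rabs Om0) by ring.
    apply Rmult_le_compat_r; lra.
  - intros t. specialize (A2 t); specialize (B2 t).
    assert (C * n <= B * n) by (apply Hmono; unfold B; lra).
    assert (C * Lam * n <= B * n) by (apply Hmono; unfold B; lra).
    repeat split; lra. }
set (z0 := fun _ : idx => 0).
assert (HPz : P z0 = fun _ => 0) by reflexivity.
assert (HQz : Q z0 = fun _ => 0).
{ apply functional_extensionality; intros t; unfold Q, z0; ring. }
assert (Halz : alp z0 = 0) by (unfold alp; rewrite HPz, Hba0; field; auto).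
assert (Hmuz : muu z0 = 0) by (unfold muu; rewrite HQz, Hbb0; field; auto).
assert (Hz0 : K z0).
{ split; [apply sym_const|]. split.
  - split; [|split]; intros; unfold z0; try ring. apply continuous_const.
  - intros i; unfold z0; rewrite Rabs_R0; lra. }
assert (Hsize : forall u, K u -> Rabs (alp u) <= B * R0 /\ Rabs (muu u) <= B * R0 /\
  forall t, Rabs (X (P u) t) <= B * R0 /\ Rabs (Y (Q u) t) <= B * R0).
{ intros u Hu. destruct (Hlin u z0 R0) as (A1 & A2 & A3); try apply Hz0; try apply Hu;
    try (apply HQ; assumption).
  - intros i. unfold z0. rewrite Rminus_0_r. apply Hu.
  - rewrite Halz, Rminus_0_r in A1. rewrite Hmuz, Rminus_0_r in A2.
    split; [exact A1|]. split; [exact A2|]. intros t. destruct (A3 t) as (_ & A4 & A5).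
    rewrite HPz, HX0, Rminus_0_r in A4. rewrite HQz, HY0, Rminus_0_r in A5. now split. }
assert (Hst : forall eps u t, 0 <= eps <= e0 -> K u ->
  dst (st eps u t) origin <= 4 * (B * R0)).
{ intros eps u t Heps Hu. destruct (Hsize u Hu) as (A1 & A2 & A3). destruct (A3 t) as [A4 A5].
  unfold dst, st, origin; simpl. rewrite !Rminus_0_r.
  assert (Rabs (eps * (sin t + Y (Q u) t)) <= e0 * (1 + 1)).
  { apply Rabs_prod_le; [rewrite Rabs_pos_eq; lra|].
    apply Rabs_sum_le; [apply Rabs_sin_le | lra]. }
  lra. }
assert (Hdiff : forall eps eps' u v n, 0 <= eps <= e0 -> 0 <= eps' <= e0 -> K u -> K v ->
  (forall i, Rabs (u i - v i) <= n) ->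
  forall i, Rabs (T eps u i - T eps' v i) <= n / 2 + L0 * Rabs (eps - eps')).
{ intros eps eps' u v n Heps Heps' Hu Hv Hn.
  assert (Hn0 : 0 <= n) by (apply Rle_trans with (2 := Hn (true, 0)), Rabs_pos).
  pose proof (Rabs_pos (eps - eps')) as Hdel.
  destruct (Hlin u v n ltac:(apply Hu) ltac:(apply Hv) (HQ u Hu) (HQ v Hv) Hn) as (A1 & A2 & A3).
  assert (HBn : 0 <= B * n) by (apply Rmult_le_pos; lra).
  assert (Hd : forall t, dst (st eps u t) (st eps' v t) <= 4 * B * n + 2 * Rabs (eps - eps')).
  { intros t. destruct (A3 t) as (A4 & A5 & A6).
    destruct (Hsize u Hu) as (_ & _ & S). destruct (S t) as [_ S1].
    unfold dst, st; simpl.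
    replace (eps * (sin t + Y (Q u) t) - eps' * (sin t + Y (Q v) t))
      with ((eps - eps') * (sin t + Y (Q u) t) + eps' * (Y (Q u) t - Y (Q v) t)) by ring.
    assert (Rabs ((eps - eps') * (sin t + Y (Q u) t) + eps' * (Y (Q u) t - Y (Q v) t))
      <= Rabs (eps - eps') * (1 + 1) + 1 * (B * n)).
    { apply Rabs_sum_le; apply Rabs_prod_le; try lra.
      - apply Rabs_sum_le; [apply Rabs_sin_le | lra].
      - rewrite Rabs_pos_eq; lra. }
    lra. }
  intros [[|] t]; specialize (Hd t); pose proof (Hst eps u t Heps Hu) as D1;
    pose proof (Hst eps' v t Heps' Hv) as D2; destruct (A3 t) as (A4 & A5 & A6); simpl.
  - assert (F1 : Rabs (Fx (st eps u t) - (- k ^ 2 * X (P u) t + c0 * alp u)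
        - (Fx (st eps' v t) - (- k ^ 2 * X (P v) t + c0 * alp v)))
      <= eta * dst (st eps u t) (st eps' v t)) by (apply HFxs; lra).
    apply Rle_trans with (eta * (4 * B * n + 2 * Rabs (eps - eps'))).
    + eapply Rle_trans; [|apply Rmult_le_compat_l; [lra | exact Hd]].
      eapply Rle_trans; [|exact F1]. right; f_equal; ring.
    + replace (eta * (4 * B * n + 2 * Rabs (eps - eps')))
        with (eta * (4 * B) * n + 2 * eta * Rabs (eps - eps')) by ring.
      rewrite HetaB.
      assert (eta <= / 2) by (apply Rinv_le_contravar; lra).
      assert (2 * eta * Rabs (eps - eps') <= L0 * Rabs (eps - eps'))
        by (apply Rmult_le_compat_r; lra).
      lra.
  - assert (F1 : Rabs (Fy (st eps u t) - (l * X (P u) t - Om0 * muu u)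
        - (Fy (st eps' v t) - (l * X (P v) t - Om0 * muu v)))
      <= eta * dst (st eps u t) (st eps' v t)) by (apply HFys; lra).
    assert (G1 := HFyl (st eps u t) (st eps' v t) ltac:(lra) ltac:(lra)).
    assert (G2 := HFyl (st eps' v t) origin ltac:(lra) ltac:(rewrite dst_refl; lra)).
    destruct (Hsize u Hu) as (_ & _ & S). destruct (S t) as [_ S1].
    set (g := Fy (st eps u t)) in *. set (g' := Fy (st eps' v t)) in *.
    set (d := 4 * B * n + 2 * Rabs (eps - eps')) in *.
    assert (Hd0 : 0 <= d) by (unfold d; lra).
    assert (M : Rabs (((1 + g + Om0 * muu u) * sin t + (1 + g) * Y (Q u) t)
        - ((1 + g' + Om0 * muu v) * sin t + (1 + g') * Y (Q v) t))
      <= (eta * d + Rabs l * (C * n)) + K1 * d * (B * R0) + K1 * (4 * (B * R0)) * (B * n)).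
    { apply forcing_difference.
      - apply Rabs_sin_le.
      - replace (1 + g + Om0 * muu u - (1 + g' + Om0 * muu v))
          with ((g - (l * X (P u) t - Om0 * muu u) - (g' - (l * X (P v) t - Om0 * muu v)))
                + l * (X (P u) t - X (P v) t)) by ring.
        apply Rabs_sum_le; [|apply Rabs_prod_le; lra].
        eapply Rle_trans; [exact F1|]. apply Rmult_le_compat_l; lra.
      - replace (1 + g - (1 + g')) with (g - g') by ring.
        eapply Rle_trans; [exact G1|]. apply Rmult_le_compat_l; lra.
      - exact S1.
      - replace (1 + g') with (g' - Fy origin) by (rewrite HFy0; ring).
        eapply Rle_trans; [exact G2|]. apply Rmult_le_compat_l; lra.
      - exact A6. }
    assert (HLam0 : 0 < / Lam) by (apply Rinv_0_lt_compat; lra).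
    assert (HLi : / Lam <= 1) by (rewrite <- Rinv_1; apply Rinv_le_contravar; lra).
    match goal with |- Rabs ?z <= _ => replace z with
      ((((1 + g + Om0 * muu u) * sin t + (1 + g) * Y (Q u) t)
        - ((1 + g' + Om0 * muu v) * sin t + (1 + g') * Y (Q v) t)) * / Lam)
      by (field; lra) end.
    rewrite Rabs_mult, (Rabs_pos_eq (/ Lam)) by lra.
    assert (E1 : eta * d = / 8 * n + 2 * eta * Rabs (eps - eps'))
      by (unfold d; rewrite <- HetaB; ring).
    assert (E2 : K1 * d * (B * R0) <= / 8 * n + 2 * K1 * Rabs (eps - eps')).
    { unfold d.
      replace (K1 * (4 * B * n + 2 * Rabs (eps - eps')) * (B * R0))
        with (K1 * (4 * (B * R0)) * B * n + 2 * K1 * Rabs (eps - eps') * (B * R0)) by ring.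
      apply Rplus_le_compat; [apply Rmult_le_compat_r; lra|].
      rewrite <- (Rmult_1_r (2 * K1 * Rabs (eps - eps'))) at 2.
      apply Rmult_le_compat_l; [|lra]. apply Rmult_le_pos; lra. }
    assert (E3 : K1 * (4 * (B * R0)) * (B * n) <= / 8 * n).
    { rewrite <- Rmult_assoc. apply Rmult_le_compat_r; lra. }
    assert (E4 : Rabs l * (C * n) * / Lam <= / 8 * n).
    { apply Rle_trans with (/ 8 * (Lam * n) * / Lam); [|right; field; lra].
      apply Rmult_le_compat_r; [lra|]. unfold Lam.
      replace (/ 8 * ((1 + 8 * (Rabs l * C)) * n)) with (/ 8 * n + Rabs l * (C * n)) by field.
      lra. }
    assert (E5 : eta <= / 32) by (apply Rinv_le_contravar; lra).
    assert (E6 : 2 * eta * Rabs (eps - eps') <= 1 * Rabs (eps - eps'))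
      by (apply Rmult_le_compat_r; lra).
    (* Three eighths and the [eps] part, for which [/ Lam <= 1] is enough; only the coupling term
       uses that [/ Lam] is small. *)
    set (w := 3 * / 8 * n + L0 * Rabs (eps - eps')).
    assert (Hw : 0 <= w).
    { unfold w. assert (0 <= L0 * Rabs (eps - eps')) by (apply Rmult_le_pos; lra). lra. }
    apply Rle_trans with ((w + Rabs l * (C * n)) * / Lam).
    + apply Rmult_le_compat_r; [lra|]. unfold w, L0.
      eapply Rle_trans; [exact M|]. rewrite Rmult_plus_distr_r. lra.
    + rewrite Rmult_plus_distr_r.
      assert (w * / Lam <= w * 1) by (apply Rmult_le_compat_l; lra).
      unfold w in *; lra. }
assert (HT00 : forall i, T 0 z0 i = 0).
{ assert (Hs0 : forall t, st 0 z0 t = origin).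
  { intros t; unfold st. rewrite HPz, HX0, Halz, Hmuz, Rmult_0_l. reflexivity. }
  intros [[|] t]; simpl; rewrite Hs0.
  - rewrite HFx0, HPz, HX0, Halz; ring.
  - rewrite HFy0, Hmuz. field; lra. }
assert (HTK : forall eps u, 0 <= eps <= e0 -> K u -> K (T eps u)).
{ intros eps u Heps Hu.
  destruct (HX (P u) (proj1 Hu)) as (_ & _ & _ & _ & [Xc [Xe Xr]]).
  destruct (HY (Q u) (HQ u Hu)) as (_ & _ & _ & _ & [Yc [Ye Yr]]).
  destruct sym_sin as [sc [se sr]].
  assert (Hste : forall t, st eps u (- t) =
    State (X (P u) t) (alp u) (muu u) (- (eps * (sin t + Y (Q u) t)))).
  { intros t; unfold st. rewrite Xe, Ye, se. f_equal; ring. }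
  assert (Hstr : forall t, st eps u (PI - t) = st eps u t).
  { intros t; unfold st. now rewrite Xr, Yr, sr. }
  assert (dc : forall t, continuous (fun t => sin t + Y (Q u) t) t)
    by (intros t; apply (continuous_plus sin (Y (Q u))); auto).
  assert (ec : forall t, continuous (fun t => st_e (st eps u t)) t).
  { intros t. apply (continuous_mult (fun _ => eps) (fun t => sin t + Y (Q u) t));
      [apply continuous_const | apply dc]. }
  assert (HFc : forall F C0 r, 0 < C0 -> rho <= r ->
    (forall p q, dst p origin <= r -> dst q origin <= r -> Rabs (F p - F q) <= C0 * dst p q) ->
    forall t, continuous (fun t => F (st eps u t)) t).
  { intros F C0 r H0 H1 H2. apply (continuous_curve F C0 r); auto.
    - intros t; apply Rle_trans with (1 := Hst eps u t Heps Hu); lra.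
    - intros t; apply continuous_const.
    - intros t; apply continuous_const. }
  split; [|split].
  - unfold P, T; split; [|split].
    + intros t.
      apply (continuous_plus (fun t => Fx (st eps u t) + k ^ 2 * X (P u) t) (fun _ => - (c0 * alp u)));
        [|apply continuous_const].
      apply (continuous_plus (fun t => Fx (st eps u t)) (fun t => k ^ 2 * X (P u) t)).
      * apply (HFc Fx K0 rx); auto.
      * apply (continuous_mult (fun _ => k ^ 2) (X (P u))); [apply continuous_const | apply Xc].
    + intros t. rewrite Hste, HFxe. unfold P in Xe; rewrite Xe. fold (P u). unfold st. ring.
    + intros t. rewrite Hstr. unfold P in Xr; now rewrite Xr.
  - unfold T; split; [|split].
    + intros t.
      apply (continuous_mult (fun t => (1 + Fy (st eps u t)) * (sin t + Y (Q u) t)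
        + Om0 * muu u * sin t) (fun _ => / Lam)); [|apply continuous_const].
      apply (continuous_plus (fun t => (1 + Fy (st eps u t)) * (sin t + Y (Q u) t))
        (fun t => Om0 * muu u * sin t)).
      * apply (continuous_mult (fun t => 1 + Fy (st eps u t)) (fun t => sin t + Y (Q u) t));
          [|apply dc].
        apply (continuous_plus (fun _ => 1) (fun t => Fy (st eps u t)));
          [apply continuous_const | apply (HFc Fy K1 ry); auto].
      * apply (continuous_mult (fun _ => Om0 * muu u) sin); [apply continuous_const | apply sc].
    + intros t. rewrite Hste, HFye, Ye, se. unfold st. field; lra.
    + intros t. now rewrite Hstr, Yr, sr.
  - intros i.
    (* Size is measured against [z0], the fixed point at [eps = 0]: half of [R0] comes from the
       contraction, half from [L0 * e0]. *)
    assert (A := Hdiff eps 0 u z0 R0 Heps ltac:(lra) Hu Hz0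
      ltac:(intros j; unfold z0; rewrite Rminus_0_r; apply Hu) i).
    rewrite HT00, !Rminus_0_r, (Rabs_pos_eq eps) in A by lra.
    assert (L0 * eps <= L0 * e0) by (apply Rmult_le_compat_l; lra). lra. }
(* Outside [[0, e0]] the default [z0] makes the statement total in [eps], as choice requires. *)
assert (Hfix : forall eps, exists u, 0 <= eps <= e0 -> K u /\ forall i, T eps u i = u i).
{ intros eps. destruct (Rle_dec 0 eps) as [H1|H1]; [|exists z0; lra].
  destruct (Rle_dec eps e0) as [H2|H2]; [|exists z0; lra].
  assert (Heps : 0 <= eps <= e0) by lra.
  destruct (contraction_fixpoint idx K (T eps) z0 R0) as [u Hu]; [| | | | |now exists u].
  - intros un u Hun Hlim. split; [|split].
    + apply (sym_uniform_limit 1 (fun n => P (un n))); [rewrite Rabs_R1; lra | apply Hun |].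
      intros e Hee. destruct (Hlim e Hee) as [n Hn]. exists n; intros t; apply (Hn (true, t)).
    + apply (sym_uniform_limit (-1) (fun n t => un n (false, t)));
        [rewrite Rabs_left; lra | apply Hun |].
      intros e Hee. destruct (Hlim e Hee) as [n Hn]. exists n; intros t; apply (Hn (false, t)).
    + intros i. apply le_epsilon. intros e Hee. destruct (Hlim e Hee) as [n Hn].
      specialize (Hn i). destruct (Hun n) as (_ & _ & A). specialize (A i).
      apply Rabs_le_between in Hn; apply Rabs_le_between in A. apply abs_le; lra.
  - intros u Hu; now apply HTK.
  - intros u v c Hu Hv Huv i.
    assert (A := Hdiff eps eps u v c Heps Heps Hu Hv Huv i).
    rewrite Rminus_diag, Rabs_R0, Rmult_0_r, Rplus_0_r in A. exact A.
  - exact Hz0.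
  - intros i. assert (HK := HTK eps z0 Heps Hz0). unfold z0 at 2. rewrite Rminus_0_r.
    apply HK. }
destruct (functional_choice _ Hfix) as [U HU].
exists e0, (B * (2 * L0)), (fun eps => alp (U eps)), (fun eps => muu (U eps)),
  (fun eps => X (P (U eps))), (fun eps => X1 (P (U eps))),
  (fun eps t => sin t + Y (Q (U eps)) t), (fun eps t => cos t + Y1 (Q (U eps)) t).
split; [exact He0|]. split.
- intros eps Heps. cbv beta. destruct (HU eps Heps) as [HKu Hfu]. set (u := U eps) in *.
  destruct (Hsize u HKu) as (A1 & A2 & A3).
  destruct (HX (P u) (proj1 HKu)) as (X_1 & X_2 & X_3 & X_4 & [Xc [Xe Xr]]).
  destruct (HY (Q u) (HQ u HKu)) as (Y_1 & Y_2 & Y_3 & Y_4 & [Yc [Ye Yr]]).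
  split; [lra|]. split; [lra|]. split; [intros t; destruct (A3 t); lra|].
  split; [now split|]. split; [rewrite sin_0, cos_0, Y_3, Y_4; lra|].
  split; [exact X_1|]. split; [|split; [|split; [|split]]].
  + intros t. eapply is_derive_eq; [apply X_2|].
    assert (F := Hfu (true, t)). simpl in F.
    assert (F' : P u t = Fx (st eps u t) + k ^ 2 * X (P u) t - c0 * alp u) by (symmetry; exact F).
    assert (E : ba (P u) = c0 * alp u) by (unfold alp; field; auto).
    rewrite F', E. unfold st. ring.
  + intros t. apply (is_derive_Rplus sin (Y (Q u))); [|apply Y_1].
    auto_derive; [exact I | ring].
  + intros t. eapply is_derive_eq.
    * apply (is_derive_Rplus cos (Y1 (Q u))); [|apply Y_2].
      instantiate (1 := - sin t). auto_derive; [exact I | ring].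
    * assert (F := Hfu (false, t)). simpl in F.
      assert (F' : Q u t = (1 + Fy (st eps u t)) * (sin t + Y (Q u) t) + Om0 * muu u * sin t).
      { unfold Q at 1. rewrite <- F. field; lra. }
      assert (E : bb (Q u) = - Om0 * muu u) by (unfold muu; field; auto).
      rewrite F', E. unfold st. ring.
  (* Translation by [2 PI] is a product of four reflections, alternately about 0 and about
     [PI / 2]. *)
  + intros t. replace (t + 2 * PI) with (PI - (- (PI - - t))) by ring.
    rewrite Xr, Xe, Xr, Xe. ring.
  + intros t. rewrite sin_plus, sin_2PI, cos_2PI.
    replace (t + 2 * PI) with (PI - (- (PI - - t))) by ring.
    rewrite Yr, Ye, Yr, Ye. ring.
- intros eps eps' Heps Heps'.
  destruct (HU eps Heps) as [HKu Hfu]. destruct (HU eps' Heps') as [HKv Hfv].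
  pose proof (Rabs_pos (eps - eps')) as Hdel.
  (* Both functions are fixed points, so [Hdiff] improves any bound [n] on their difference to
     [n / 2 + L0 * Rabs (eps - eps')]. *)
  assert (Hn : forall i, Rabs (U eps i - U eps' i) <= 2 * (L0 * Rabs (eps - eps'))).
  { apply (halving_bound idx (fun i => U eps i - U eps' i) (2 * R0)).
    - apply Rmult_le_pos; lra.
    - intros n Hn i. rewrite <- Hfu, <- Hfv. now apply Hdiff.
    - intros i. unfold Rminus. replace (2 * R0) with (R0 + R0) by ring.
      apply Rabs_sum_le; [apply HKu | rewrite Rabs_Ropp; apply HKv]. }
  destruct (Hlin (U eps) (U eps') _ (proj1 HKu) (proj1 HKv) (HQ _ HKu) (HQ _ HKv) Hn)
    as (A1 & A2 & _).
  replace (B * (2 * L0) * Rabs (eps - eps')) with (B * (2 * (L0 * Rabs (eps - eps')))) by ring.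
  now split.
Qed.

(** * Linearisation at the circular motion *)

Lemma sin_angle_bounds (N k : nat) : (1 <= k <= 2 * N - 1)%nat -> 0 < sin (hh_angle N k) <= 1.
Proof.
intros Hk. pose proof PI_RGT_0 as HPI. split; [|apply SIN_bound].
assert (HN : 0 < 2 * INR N).
{ assert (0 < INR N) by (apply lt_0_INR; lia). lra. }
assert (Hk1 : 0 < INR k) by (apply lt_0_INR; lia).
assert (Hk2 : INR k < 2 * INR N).
{ replace (2 * INR N) with (INR (2 * N)) by (rewrite mult_INR; reflexivity).
  apply lt_INR; lia. }
unfold hh_angle. apply sin_gt_0.
- apply Rdiv_lt_0_compat; [|exact HN]. now apply Rmult_lt_0_compat.
- apply Rmult_lt_reg_r with (2 * INR N); [exact HN|].
  replace (INR k * PI / (2 * INR N) * (2 * INR N)) with (INR k * PI) by (field; lra).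
  nra.
Qed.

(* Concavity of the sine on [0, PI]. *)
Lemma sin_angle_mid (N k : nat) : (1 <= k)%nat -> (S (S k) <= 2 * N - 1)%nat ->
  / sin (hh_angle N (S k)) <= / sin (hh_angle N k) + / sin (hh_angle N (S (S k))).
Proof.
intros Hk1 Hk2.
destruct (sin_angle_bounds N k ltac:(lia)) as [A _].
destruct (sin_angle_bounds N (S k) ltac:(lia)) as [B _].
destruct (sin_angle_bounds N (S (S k)) ltac:(lia)) as [C _].
assert (HN : 0 < INR N) by (apply lt_0_INR; lia).
assert (E := form3 (hh_angle N k) (hh_angle N (S (S k)))).
replace ((hh_angle N k + hh_angle N (S (S k))) / 2) with (hh_angle N (S k)) in E
  by (unfold hh_angle; rewrite !S_INR; field; lra).
set (x := (hh_angle N k - hh_angle N (S (S k))) / 2) in *.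
pose proof (COS_bound x) as Hx.
pose proof (Rinv_0_lt_compat _ A); pose proof (Rinv_0_lt_compat _ C).
(* The two outer sines add up to at most twice the middle one, so one of them does not exceed it,
   and its inverse alone dominates. *)
destruct (Rle_dec (sin (hh_angle N k)) (sin (hh_angle N (S k)))) as [D|D].
- pose proof (Rinv_le_contravar _ _ A D); lra.
- assert (F : sin (hh_angle N (S (S k))) <= sin (hh_angle N (S k))) by nra.
  pose proof (Rinv_le_contravar _ _ C F); lra.
Qed.

Lemma sum_1_S (f : nat -> R) (n : nat) : sum_n_m f 1 (S n) = sum_n_m f 1 n + f (S n).
Proof. apply (sum_n_Sm f 1 n); lia. Qed.

(** As [s <= 1], an odd index contributes [4 / s ^ 3 > 3 / s]: one [/ s] for itself and one for each
    even neighbour, whose term is split by [sin_angle_mid]. The extra term on the left is the share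
    kept for the next even index. *)
Lemma sum_inv_sin_lt_aux (N n : nat) : (n < N)%nat ->
  sum_n_m (fun k => / sin (hh_angle N k)) 1 (S (2 * n)) + / sin (hh_angle N (S (2 * n)))
  < sum_n_m (fun k => ((-1) ^ k - 1) ^ 2 / sin (hh_angle N k) ^ 3) 1 (S (2 * n)).
Proof.
assert (Hodd : forall s, 0 < s <= 1 -> 3 * / s < 4 / s ^ 3).
{ intros s Hs. assert (Hi : 1 <= / s) by (rewrite <- Rinv_1; apply Rinv_le_contravar; lra).
  unfold Rdiv. rewrite <- pow_inv. simpl. nra. }
induction n as [|n IH]; intros Hn.
- simpl (2 * 0)%nat. rewrite !sum_n_n.
  destruct (sin_angle_bounds N 1 ltac:(lia)) as [A A']. specialize (Hodd _ (conj A A')).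
  pose proof (Rinv_0_lt_compat _ A).
  replace (((-1) ^ 1 - 1) ^ 2) with 4 by ring. lra.
- specialize (IH ltac:(lia)). replace (S (2 * S n)) with (S (S (S (2 * n)))) by lia.
  assert (Ee : ((-1) ^ S (S (2 * n)) - 1) ^ 2 = 0).
  { replace (S (S (2 * n))) with (2 * S n)%nat by lia. rewrite pow_1_even; ring. }
  assert (Eo : ((-1) ^ S (S (S (2 * n))) - 1) ^ 2 = 4).
  { replace (S (S (S (2 * n)))) with (S (2 * S n)) by lia. rewrite pow_1_odd; ring. }
  rewrite !(sum_1_S _ (S (S (2 * n)))), !(sum_1_S _ (S (2 * n))), Ee, Eo.
  assert (M := sin_angle_mid N (S (2 * n)) ltac:(lia) ltac:(lia)).
  destruct (sin_angle_bounds N (S (S (S (2 * n)))) ltac:(lia)) as [A A'].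
  specialize (Hodd _ (conj A A')).
  unfold Rdiv at 2; rewrite Rmult_0_l. lra.
Qed.

Definition inv_sin_sum (N : nat) : R :=
  sum_n_m (fun k => / sin (hh_angle N k)) 1 (2 * N - 1).

Definition inv_sin3_sum (N : nat) : R :=
  sum_n_m (fun k => ((-1) ^ k - 1) ^ 2 / sin (hh_angle N k) ^ 3) 1 (2 * N - 1).

Lemma sum_inv_sin_lt (N : nat) : (1 <= N)%nat ->
  0 < inv_sin_sum N < inv_sin3_sum N.
Proof.
intros HN. unfold inv_sin_sum, inv_sin3_sum. split.
- assert (H : forall n, (n <= 2 * N - 2)%nat ->
    0 < sum_n_m (fun k => / sin (hh_angle N k)) 1 (S n)).
  { induction n as [|n IH]; intros Hn.
    - rewrite sum_n_n. apply Rinv_0_lt_compat, sin_angle_bounds; lia.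
    - rewrite sum_n_Sm by lia.
      apply Rplus_lt_0_compat; [apply IH; lia|].
      apply Rinv_0_lt_compat, sin_angle_bounds; lia. }
  replace (2 * N - 1)%nat with (S (2 * N - 2)) by lia. apply H; lia.
- assert (H := sum_inv_sin_lt_aux N (N - 1) ltac:(lia)).
  replace (S (2 * (N - 1))) with (2 * N - 1)%nat in H by lia.
  destruct (sin_angle_bounds N (2 * N - 1) ltac:(lia)) as [A _].
  pose proof (Rinv_0_lt_compat _ A). lra.
Qed.

(** * Differentials of the rescaled accelerations *)

Lemma Rpower_sqr_half (w : R) (n : nat) : 0 < w -> Rpower (w ^ 2) (INR n / 2) = w ^ n.
Proof.
intros Hw. rewrite <- (Rpower_pow 2 w Hw), Rpower_mult, <- (Rpower_pow n w Hw).
f_equal. simpl; field.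
Qed.

Lemma sdiff1_inv_Rpower (w : R) : 0 < w ->
  sdiff1 (fun t => / Rpower t (3 / 2)) (w ^ 2) (- (3 / 2) * / w ^ 5).
Proof.
intros Hw. assert (Hw2 : 0 < w ^ 2) by now apply pow_lt.
replace (- (3 / 2) * / w ^ 5)
  with ((fun t => - (3 / 2) * Rpower t (- (3 / 2) - 1)) (w ^ 2)).
- apply (sdiff1_derive _ (fun t => - (3 / 2) * Rpower t (- (3 / 2) - 1)) (w ^ 2) (w ^ 2) Hw2).
  + intros s Hs. apply Rabs_def2 in Hs.
    apply (is_derive_Rext (fun t => Rpower t (- (3 / 2)))); [intros; apply Rpower_Ropp|].
    apply is_derive_Reals, derivable_pt_lim_power. lra.
  + apply (ex_derive_continuous (fun t => - (3 / 2) * Rpower t (- (3 / 2) - 1))).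
    exists (- (3 / 2) * ((- (3 / 2) - 1) * Rpower (w ^ 2) (- (3 / 2) - 1 - 1))).
    apply (is_derive_scal (fun t => Rpower t (- (3 / 2) - 1))).
    apply is_derive_Reals, derivable_pt_lim_power. exact Hw2.
- cbv beta. f_equal. replace (- (3 / 2) - 1) with (- (INR 5 / 2)) by (simpl; field).
  now rewrite Rpower_Ropp, Rpower_sqr_half.
Qed.

Lemma sdiff1_inv_cube (r : R) : 0 < r -> sdiff1 (fun t => / t ^ 3) r (- 3 / r ^ 4).
Proof.
intros Hr. apply (sdiff1_derive _ (fun t => - 3 / t ^ 4) r r Hr).
- intros s Hs. apply Rabs_def2 in Hs. auto_derive.
  + apply (pow_nonzero s 3); lra.
  + field; lra.
- apply (ex_derive_continuous (fun t => - 3 / t ^ 4)). auto_derive.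
  apply (pow_nonzero r 4); lra.
Qed.

(** At the circular motion every squared distance is a perfect square, so the power [3 / 2] becomes
    a cube. *)
Lemma dist2_origin (N k : nat) (r : R) :
  hh_dist2 N k (r + 0) 0 = (2 * r * sin (hh_angle N k)) ^ 2.
Proof. unfold hh_dist2; ring. Qed.

(** The height enters only through its square, so it leaves no trace in the differential; planar and
    vertical motions decouple at first order. *)
Lemma sdiff_kernel (N k : nat) (r : R) : (1 <= k <= 2 * N - 1)%nat -> 0 < r ->
  sdiff (fun p => / Rpower (hh_dist2 N k (r + st_x p) (st_e p)) (3 / 2))
    (fun p => - 3 / (8 * r ^ 4 * sin (hh_angle N k) ^ 3) * st_x p).
Proof.
intros Hk Hr. destruct (sin_angle_bounds N k Hk) as [Hs _].
set (s := sin (hh_angle N k)) in *. set (c := ((-1) ^ k - 1) ^ 2).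
destruct (sdiff_coord r) as (Hx & _ & _ & _).
destruct (sdiff_coord 0) as (_ & _ & _ & He).
assert (H2 := sdiff_plus _ _ _ _
  (sdiff_scal (4 * s ^ 2) _ _ (sdiff_comp _ _ _ _ Hx (sdiff1_sqr _)))
  (sdiff_scal c _ _ (sdiff_comp _ _ _ _ He (sdiff1_sqr _)))).
assert (H3 : sdiff (fun p => hh_dist2 N k (r + st_x p) (st_e p))
  (fun p => 8 * r * s ^ 2 * st_x p)).
{ eapply sdiff_ext; [| |exact H2]; intros p; cbv beta; unfold hh_dist2; fold s c;
    simpl; ring. }
assert (Hw : 0 < 2 * r * s) by (apply Rmult_lt_0_compat; lra).
assert (H4 := sdiff1_inv_Rpower _ Hw).
unfold s in H4; rewrite <- (dist2_origin N k r) in H4; fold s in H4.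
eapply sdiff_ext; [| |exact (sdiff_comp (fun t => / Rpower t (3 / 2)) _ _ _ H3 H4)].
- reflexivity.
- intros p. cbv beta. fold s. field; lra.
Qed.

Lemma kernel_origin (N k : nat) (r : R) : (1 <= k <= 2 * N - 1)%nat -> 0 < r ->
  Rpower (hh_dist2 N k (r + 0) 0) (3 / 2) = 8 * r ^ 3 * sin (hh_angle N k) ^ 3.
Proof.
intros Hk Hr. destruct (sin_angle_bounds N k Hk) as [Hs _].
rewrite dist2_origin. replace (3 / 2) with (INR 3 / 2) by (simpl; field).
rewrite Rpower_sqr_half; [ring|]. apply Rmult_lt_0_compat; lra.
Qed.

Lemma sum_scal (f g : nat -> R) (c : R) (n m : nat) :
  (forall k, (n <= k <= m)%nat -> f k = c * g k) -> sum_n_m f n m = c * sum_n_m g n m.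
Proof.
intros H. rewrite (sum_n_m_ext_loc f (fun k => c * g k)) by exact H.
exact (sum_n_m_mult_l c g n m).
Qed.

(** [hh_f] multiplied by [w^-2], that is, the acceleration of [x] in the time [w t]. *)
Definition accel_r (N : nat) (m r0 mu0 A0 : R) (p : state) : R :=
  (mu0 + st_mu p) * ((A0 + st_al p) / (r0 + st_x p) ^ 3
  - 2 * (r0 + st_x p) * m * sum_n_m (fun k : nat =>
      sin (hh_angle N k) ^ 2 / Rpower (hh_dist2 N k (r0 + st_x p) (st_e p)) (3 / 2))
      1 (2 * N - 1)).

(** [hh_g] in the time [w t] with its factor [d] removed, which is the factor [Fy] in
    [y'' = Fy y]. *)
Definition accel_d (N : nat) (m r0 mu0 : R) (p : state) : R :=
  (mu0 + st_mu p) * (- (m / 2) * sum_n_m (fun k : nat =>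
      ((-1) ^ k - 1) ^ 2 / Rpower (hh_dist2 N k (r0 + st_x p) (st_e p)) (3 / 2))
      1 (2 * N - 1)).

Lemma sum_r_origin (N : nat) (r0 : R) : 0 < r0 -> sum_n_m (fun k : nat =>
      sin (hh_angle N k) ^ 2 / Rpower (hh_dist2 N k (r0 + 0) 0) (3 / 2)) 1 (2 * N - 1)
  = / (8 * r0 ^ 3) * (inv_sin_sum N).
Proof.
intros hr0. apply sum_scal. intros k Hk. rewrite kernel_origin by assumption.
destruct (sin_angle_bounds N k Hk) as [Hs _]. field; lra.
Qed.

Lemma sum_d_origin (N : nat) (r0 : R) : 0 < r0 -> sum_n_m (fun k : nat =>
      ((-1) ^ k - 1) ^ 2 / Rpower (hh_dist2 N k (r0 + 0) 0) (3 / 2)) 1 (2 * N - 1)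
  = / (8 * r0 ^ 3) * (inv_sin3_sum N).
Proof.
intros hr0. apply sum_scal. intros k Hk. rewrite kernel_origin by assumption.
destruct (sin_angle_bounds N k Hk) as [Hs _]. field; lra.
Qed.

(** This value of [A0] balances the centrifugal term and the attraction at [r0]. The factor of
    [mu0 + st_mu p] then vanishes at the origin, which is why [st_mu] is absent from the
    differential. *)
Lemma sdiff_accel_r (N : nat) (m r0 mu0 : R) : 0 < r0 ->
  sdiff (accel_r N m r0 mu0 (m * (inv_sin_sum N) * r0 / 4))
  (fun p => - (mu0 * m * (inv_sin_sum N) / (4 * r0 ^ 3)) * st_x p + mu0 / r0 ^ 3 * st_al p).
Proof.
intros hr0. set (A0 := m * (inv_sin_sum N) * r0 / 4).
destruct (sdiff_coord r0) as (Hx & _ & _ & _).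
destruct (sdiff_coord A0) as (_ & Ha & _ & _).
destruct (sdiff_coord mu0) as (_ & _ & Hm & _).
assert (Hsum := sdiff_sum (fun k p => sin (hh_angle N k) ^ 2 *
    / Rpower (hh_dist2 N k (r0 + st_x p) (st_e p)) (3 / 2))
  (fun k => - 3 / (8 * r0 ^ 4) * / sin (hh_angle N k)) (2 * N - 1)
  ltac:(intros k Hk; destruct (sin_angle_bounds N k Hk) as [Hs _];
    eapply sdiff_ext; [| |exact (sdiff_scal (sin (hh_angle N k) ^ 2) _ _
      (sdiff_kernel N k r0 Hk hr0))]; intros p; cbv beta; [reflexivity | field; lra])).
rewrite (sum_scal _ _ (- 3 / (8 * r0 ^ 4)) 1 (2 * N - 1) (fun k _ => eq_refl)) in Hsum.
fold (inv_sin_sum N) in Hsum.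
assert (H3 : sdiff1 (fun t => / t ^ 3) (r0 + st_x origin) (- 3 / r0 ^ 4))
  by (simpl st_x; rewrite Rplus_0_r; now apply sdiff1_inv_cube).
assert (H := sdiff_mult _ _ _ _ Hm (sdiff_plus _ _ _ _
  (sdiff_mult _ _ _ _ Ha (sdiff_comp _ _ _ _ Hx H3))
  (sdiff_scal (- (2 * m)) _ _ (sdiff_mult _ _ _ _ Hx Hsum)))).
eapply sdiff_ext; [| |exact H]; intros p; cbv beta.
- unfold accel_r, Rdiv. fold A0. ring.
- simpl (st_x origin); simpl (st_e origin); simpl (st_al origin); simpl (st_mu origin).
  assert (E := sum_r_origin N r0 hr0). unfold Rdiv at 1 in E. rewrite E.
  unfold A0. field; lra.
Qed.

(** The coefficient of [st_mu] is the vertical stiffness at the circular motion; for [m > 0] it is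
    nonzero, so rescaling time detunes the vertical oscillator at first order. [reversible_center]
    accepts any slope [l], hence the existential. *)
Lemma sdiff_accel_d (N : nat) (m r0 mu0 : R) : 0 < r0 ->
  exists l, sdiff (accel_d N m r0 mu0)
  (fun p => l * st_x p - m * (inv_sin3_sum N) / (16 * r0 ^ 3) * st_mu p).
Proof.
intros hr0. destruct (sdiff_coord mu0) as (_ & _ & Hm & _).
assert (Hsum := sdiff_sum (fun k p => ((-1) ^ k - 1) ^ 2 *
    / Rpower (hh_dist2 N k (r0 + st_x p) (st_e p)) (3 / 2))
  (fun k => ((-1) ^ k - 1) ^ 2 * (- 3 / (8 * r0 ^ 4 * sin (hh_angle N k) ^ 3))) (2 * N - 1)
  ltac:(intros k Hk; 
    eapply sdiff_ext; [| |exact (sdiff_scal (((-1) ^ k - 1) ^ 2) _ _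
      (sdiff_kernel N k r0 Hk hr0))]; intros p; cbv beta; [reflexivity | ring])).
set (l := sum_n_m (fun k => ((-1) ^ k - 1) ^ 2 * (- 3 / (8 * r0 ^ 4 * sin (hh_angle N k) ^ 3)))
  1 (2 * N - 1)) in Hsum.
exists (- mu0 * (m / 2) * l).
assert (H := sdiff_mult _ _ _ _ Hm (sdiff_scal (- (m / 2)) _ _ Hsum)).
eapply sdiff_ext; [| |exact H]; intros p; cbv beta.
- unfold accel_d, Rdiv. ring.
- simpl (st_x origin); simpl (st_e origin); simpl (st_mu origin).
  assert (E := sum_d_origin N r0 hr0). unfold Rdiv at 1 in E. rewrite E. field; lra.
Qed.

(** * The hip-hop family *)

Lemma second_derivative_scale (f f1 f2 : R -> R) (c0 c w : R) :
  (forall t, is_derive f t (f1 t)) -> (forall t, is_derive f1 t (f2 t)) ->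
  (forall t, second_derivative_at (fun s => c0 + c * f (w * s)) t (c * w ^ 2 * f2 (w * t))) /\
  Derive (fun s => c0 + c * f (w * s)) 0 = c * w * f1 0.
Proof.
intros H1 H2.
assert (D : forall t, is_derive (fun s => c0 + c * f (w * s)) t (c * w * f1 (w * t))).
{ intros t. eapply is_derive_eq.
  - apply (is_derive_Rplus (fun _ => c0) (fun s => c * f (w * s)) t 0).
    + apply (is_derive_const c0).
    + apply is_derive_scale, H1.
  - ring. }
assert (E : Derive (fun s => c0 + c * f (w * s)) = fun t => c * w * f1 (w * t))
  by (apply functional_extensionality; intros t; apply is_derive_unique, D).
split.
- intros t. split; [eexists; apply D|]. rewrite E. eapply is_derive_eq.
  + apply (is_derive_scale f1), H2.
  + ring.
- rewrite E. now rewrite Rmult_0_r.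
Qed.

Lemma continuous_lipschitz_scale (f : R -> R) (c e L t : R) : 0 < c -> c <= e -> 0 < t < 1 ->
  (forall x y, 0 <= x <= e -> 0 <= y <= e -> Rabs (f x - f y) <= L * Rabs (x - y)) ->
  continuous (fun s => f (c * s)) t.
Proof.
intros Hc Hce Ht H. apply continuous_eps. intros eta Heta.
set (M := Rabs L * c + 1).
assert (HM : 0 < M).
{ unfold M. assert (0 <= Rabs L * c) by (apply Rmult_le_pos; [apply Rabs_pos | lra]). lra. }
assert (Hd : 0 < eta / M) by now apply Rdiv_lt_0_compat.
exists (Rmin (eta / M) (Rmin t (1 - t))). split; [repeat apply Rmin_glb_lt; lra|].
intros s Hs.
pose proof (Rmin_l (eta / M) (Rmin t (1 - t))); pose proof (Rmin_r (eta / M) (Rmin t (1 - t))).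
pose proof (Rmin_l t (1 - t)); pose proof (Rmin_r t (1 - t)).
assert (Hs' : 0 < s < 1) by (apply Rabs_def2 in Hs; lra).
eapply Rle_trans; [apply H; split; nra|].
rewrite <- Rmult_minus_distr_l, Rabs_mult, (Rabs_pos_eq c) by lra.
pose proof (Rle_abs L). pose proof (Rabs_pos (s - t)).
apply Rle_trans with (M * Rabs (s - t)).
- unfold M. assert (0 <= c * Rabs (s - t)) by (apply Rmult_le_pos; lra). nra.
- replace eta with (M * (eta / M)) by (field; lra). apply Rmult_le_compat_l; lra.
Qed.

(* For small [x] the Lipschitz variation of [M] cannot compensate that of [x]. *)
Lemma scaled_speed_injective (mu0 L e1 x x' M M' : R) : 0 < x <= e1 -> 0 < x' <= e1 ->
  e1 * Rabs L < mu0 / 2 -> mu0 / 2 <= mu0 + M -> mu0 / 2 <= mu0 + M' ->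
  Rabs (M - M') <= L * Rabs (x - x') ->
  x / sqrt (mu0 + M) = x' / sqrt (mu0 + M') -> x = x'.
Proof.
intros Hx Hx' HL HM HM' HMM E.
assert (Hmu : 0 < mu0).
{ assert (0 <= e1 * Rabs L) by (apply Rmult_le_pos; [lra | apply Rabs_pos]). lra. }
assert (E2 : x ^ 2 * (mu0 + M') = x' ^ 2 * (mu0 + M)).
{ assert (Hs : 0 < sqrt (mu0 + M)) by (apply sqrt_lt_R0; lra).
  assert (Hs' : 0 < sqrt (mu0 + M')) by (apply sqrt_lt_R0; lra).
  assert (E1 : x * sqrt (mu0 + M') = x' * sqrt (mu0 + M)).
  { replace x with (x / sqrt (mu0 + M) * sqrt (mu0 + M)) by (field; lra).
    rewrite E. field; lra. }
  rewrite <- (sqrt_sqrt (mu0 + M)), <- (sqrt_sqrt (mu0 + M')) by lra.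
  replace (x ^ 2 * (sqrt (mu0 + M') * sqrt (mu0 + M'))) with ((x * sqrt (mu0 + M')) ^ 2) by ring.
  rewrite E1; ring. }
destruct (Req_dec x x') as [|Hne]; [assumption | exfalso].
assert (Hd : 0 < Rabs (x - x')) by (apply Rabs_pos_lt; lra).
(* The left side has size at least [Rabs (x - x') * x' * (mu0 / 2)], the right side at most
   [x' * e1 * Rabs L * Rabs (x - x')], which is strictly smaller when [x <> x']. *)
assert (E3 : (x - x') * ((x + x') * (mu0 + M')) = x' ^ 2 * (M - M')) by nra.
assert (E4 : Rabs (x - x') * ((x + x') * (mu0 + M')) = x' ^ 2 * Rabs (M - M')).
{ rewrite <- (Rabs_pos_eq ((x + x') * (mu0 + M'))) by (apply Rmult_le_pos; lra).
  rewrite <- (Rabs_pos_eq (x' ^ 2)) by apply pow2_ge_0.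
  rewrite <- !Rabs_mult. now f_equal. }
assert (HL' : L * Rabs (x - x') <= Rabs L * Rabs (x - x'))
  by (apply Rmult_le_compat_r; [lra | apply Rle_abs]).
assert (A : x' ^ 2 * Rabs (M - M') <= x' * (e1 * Rabs L * Rabs (x - x'))).
{ apply Rle_trans with (x' ^ 2 * (Rabs L * Rabs (x - x'))).
  - apply Rmult_le_compat_l; [apply pow2_ge_0 | lra].
  - replace (x' ^ 2 * (Rabs L * Rabs (x - x'))) with (x' * (x' * Rabs L * Rabs (x - x'))) by ring.
    apply Rmult_le_compat_l; [lra|]. apply Rmult_le_compat_r; [lra|].
    apply Rmult_le_compat_r; [apply Rabs_pos | lra]. }
assert (A1 : x' * (e1 * Rabs L * Rabs (x - x')) < x' * (mu0 / 2 * Rabs (x - x')))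
  by (apply Rmult_lt_compat_l; [lra | now apply Rmult_lt_compat_r]).
assert (A2 : x' * (mu0 / 2) <= (x + x') * (mu0 + M')) by (apply Rmult_le_compat; lra).
assert (A3 : Rabs (x - x') * (x' * (mu0 / 2)) <= Rabs (x - x') * ((x + x') * (mu0 + M')))
  by (apply Rmult_le_compat_l; lra).
lra.
Qed.

Theorem theorem6 (N : nat) (m r0 : R) (hN : (2 <= N)%nat) (hm : 0 < m) (hr0 : 0 < r0) :
  exists a b u : R -> R, hh_periodic_family N m r0 a b u.
Proof.
destruct (sum_inv_sin_lt N ltac:(lia)) as [HS1 HS3].
set (S1 := inv_sin_sum N) in *. set (S3 := inv_sin3_sum N) in *.
assert (Hr3 : 0 < r0 ^ 3) by now apply pow_lt.
assert (HmS : 0 < m * S3) by (apply Rmult_lt_0_compat; lra).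
set (mu0 := 16 * r0 ^ 3 / (m * S3)). set (A0 := m * S1 * r0 / 4).
assert (Hmu0 : 0 < mu0) by (apply Rdiv_lt_0_compat; lra).
assert (HA0 : 0 < A0) by (unfold A0, Rdiv; repeat apply Rmult_lt_0_compat; lra).
set (k := sqrt (mu0 * m * S1 / (4 * r0 ^ 3))).
assert (Hk2 : mu0 * m * S1 / (4 * r0 ^ 3) = 4 * (S1 / S3)) by (unfold mu0; field; lra).
assert (Hq : 0 < S1 / S3 < 1).
{ split; [apply Rdiv_lt_0_compat; lra|]. apply Rmult_lt_reg_r with S3; [lra|].
  unfold Rdiv. rewrite Rmult_assoc, Rinv_l; lra. }
assert (Hk : 0 < k < 2).
{ unfold k. rewrite Hk2. split; [apply sqrt_lt_R0; lra|].
  replace 2 with (sqrt (2 * 2)) by (apply sqrt_square; lra). apply sqrt_lt_1; lra. }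
assert (Hkk : k ^ 2 = mu0 * m * S1 / (4 * r0 ^ 3)).
{ unfold k. apply pow2_sqrt. lra. }
assert (HFx := sdiff_accel_r N m r0 mu0 hr0). fold S1 A0 in HFx. rewrite <- Hkk in HFx.
destruct (sdiff_accel_d N m r0 mu0 hr0) as [l HFy]. fold S3 in HFy.
(* Corrections within [rho] keep [mu0 + mu], [r0 + x] and [A0 + al] positive, so the time scale, the
   orbit and the angular momentum are all defined. *)
set (rho := Rmin (mu0 / 2) (Rmin (r0 / 2) (A0 / 2))).
assert (Hrho : 0 < rho) by (unfold rho; repeat apply Rmin_glb_lt; lra).
assert (Hrho' : rho <= mu0 / 2 /\ rho <= r0 / 2 /\ rho <= A0 / 2).
{ unfold rho. pose proof (Rmin_l (mu0 / 2) (Rmin (r0 / 2) (A0 / 2)));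
  pose proof (Rmin_r (mu0 / 2) (Rmin (r0 / 2) (A0 / 2)));
  pose proof (Rmin_l (r0 / 2) (A0 / 2)); pose proof (Rmin_r (r0 / 2) (A0 / 2)); lra. }
destruct Hrho' as (Hrmu & Hrr & HrA).
assert (Hdist : forall j r e, hh_dist2 N j r (- e) = hh_dist2 N j r e)
  by (intros; unfold hh_dist2; ring).
destruct (reversible_center k (mu0 / r0 ^ 3) (m * S3 / (16 * r0 ^ 3)) l rho
  (accel_r N m r0 mu0 A0) (accel_d N m r0 mu0)) as
  (e0 & L & al & mu & x & x1 & y & y1 & He0 & Hsol & Hlip).
- exact Hk.
- apply Rgt_not_eq, Rdiv_lt_0_compat; lra.
- apply Rgt_not_eq, Rdiv_lt_0_compat; lra.
- exact Hrho.
- eapply sdiff_ext; [| |exact HFx]; intros p; cbv beta; [reflexivity | ring].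
- exact HFy.
- unfold accel_r, origin; cbv [st_x st_al st_mu st_e].
  rewrite (sum_r_origin N r0 hr0). fold S1. unfold A0. field; lra.
- unfold accel_d, origin; cbv [st_x st_al st_mu st_e].
  rewrite (sum_d_origin N r0 hr0). fold S3. unfold mu0. field; lra.
- intros v al mu e. unfold accel_r; cbv [st_x st_al st_mu st_e].
  rewrite (sum_n_m_ext _ _ _ _ (fun j => f_equal (fun d => sin (hh_angle N j) ^ 2 / Rpower d (3 / 2))
    (Hdist j (r0 + v) e))). reflexivity.
- intros v al mu e. unfold accel_d; cbv [st_x st_al st_mu st_e].
  rewrite (sum_n_m_ext _ _ _ _ (fun j => f_equal (fun d => ((-1) ^ j - 1) ^ 2 / Rpower d (3 / 2))
    (Hdist j (r0 + v) e))). reflexivity.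
(* The second bound gives [e1 * Rabs L < mu0 / 2], as [scaled_speed_injective] demands; the [+ 1]
   covers [L = 0]. *)
- set (e1 := Rmin e0 (mu0 / (4 * (Rabs L + 1)))).
  pose proof (Rabs_pos L) as HL.
  assert (Hq1 : 0 < mu0 / (4 * (Rabs L + 1))) by (apply Rdiv_lt_0_compat; lra).
  assert (He1 : 0 < e1) by (apply Rmin_glb_lt; assumption).
  assert (He10 : e1 <= e0) by apply Rmin_l.
  assert (He1L : e1 * Rabs L < mu0 / 2).
  { apply Rle_lt_trans with (mu0 / (4 * (Rabs L + 1)) * (Rabs L + 1)).
    - apply Rmult_le_compat; try lra. apply Rmin_r.
    - apply Rle_lt_trans with (mu0 / 4); [right; field; lra | lra]. }
  assert (Hr : forall s, 0 < s < 1 -> 0 < e1 * s <= e1) by (intros; split; nra).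
  assert (Hr' : forall s, 0 < s < 1 -> 0 <= e1 * s <= e0)
    by (intros s Hs; specialize (Hr s Hs); lra).
  assert (Hmu : forall s, 0 < s < 1 -> mu0 / 2 <= mu0 + mu (e1 * s)).
  { intros s Hs. destruct (Hsol _ (Hr' s Hs)) as (_ & A & _). apply Rabs_le_between in A. lra. }
  assert (Hal : forall s, 0 < s < 1 -> 0 < A0 + al (e1 * s)).
  { intros s Hs. destruct (Hsol _ (Hr' s Hs)) as (A & _). apply Rabs_le_between in A. lra. }
  (* The amplitude is [eps = e1 * s]; [b] is the initial slope [eps * w] of [eps * y (w t)], since
     [y' 0 = 1]. *)
  exists (fun s => sqrt (A0 + al (e1 * s))), (fun s => e1 * s / sqrt (mu0 + mu (e1 * s))), (fun _ => 0).
  split; [|split].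
  + intros s Hs.
    assert (Cal : continuous (fun s => al (e1 * s)) s).
    { apply (continuous_lipschitz_scale al e1 e0 L); auto. intros; now apply Hlip. }
    assert (Cmu : continuous (fun s => mu (e1 * s)) s).
    { apply (continuous_lipschitz_scale mu e1 e0 L); auto. intros; now apply Hlip. }
    split; [|split; [|apply continuous_const]].
    * apply (continuous_comp (fun s => A0 + al (e1 * s)) sqrt).
      -- apply (continuous_plus (fun _ => A0) (fun s => al (e1 * s)));
           [apply continuous_const | exact Cal].
      -- apply continuous_sqrt.
    * specialize (Hmu s Hs).
      apply (continuous_mult (fun s => e1 * s) (fun s => / sqrt (mu0 + mu (e1 * s)))).
      -- apply (continuous_mult (fun _ => e1) (fun s => s));
           [apply continuous_const | apply continuous_id].
      -- apply (continuous_comp (fun s => mu0 + mu (e1 * s)) (fun t => / sqrt t)).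
         ++ apply (continuous_plus (fun _ => mu0) (fun s => mu (e1 * s)));
              [apply continuous_const | exact Cmu].
         ++ apply (ex_derive_continuous (fun t => / sqrt t)). auto_derive.
            split; [lra|]. split; [|trivial]. apply Rgt_not_eq, sqrt_lt_R0; lra.
  + intros s s' Hs Hs' _ E _.
    apply Rmult_eq_reg_l with e1; [|lra].
    apply (scaled_speed_injective mu0 L e1 _ _ (mu (e1 * s)) (mu (e1 * s'))); auto.
    apply Hlip; auto.
  + intros s Hs. specialize (Hmu s Hs). specialize (Hal s Hs). specialize (Hr s Hs).
    destruct (Hsol _ (Hr' s Hs)) as
      (_ & _ & Hx & [x_0 x1_0] & [y_0 y1_0] & Hx1 & Hx2 & Hy1 & Hy2 & Hxp & Hyp).
    set (eps := e1 * s) in *.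
    assert (Hsq : 0 < sqrt (mu0 + mu eps)) by (apply sqrt_lt_R0; lra).
    set (w := / sqrt (mu0 + mu eps)).
    assert (Hw : 0 < w) by now apply Rinv_0_lt_compat.
    assert (Hw2 : w ^ 2 = / (mu0 + mu eps)).
    { unfold w. rewrite pow_inv. f_equal. apply pow2_sqrt; lra. }
    assert (Hpos : forall t, 0 < r0 + x eps t).
    { intros t. specialize (Hx t). apply Rabs_le_between in Hx. lra. }
    split; [apply Rgt_not_eq, Rdiv_lt_0_compat; lra|].
    destruct (second_derivative_scale _ _ _ r0 1 w Hx1 Hx2) as [Rd R1].
    destruct (second_derivative_scale _ _ _ 0 eps w Hy1 Hy2) as [Dd D1].
    (* The resting massless body in the same scaled form, with all constants zero; hence [0 + 0 * 0]
       below. *)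
    destruct (second_derivative_scale (fun _ => 0) (fun _ => 0) (fun _ => 0) 0 0 0
      (fun t => is_derive_const 0 t) (fun t => is_derive_const 0 t)) as [Zd Z1].
    exists (fun t => r0 + 1 * x eps (w * t)), (fun t => 0 + eps * y eps (w * t)), (fun t => 0 + 0 * 0).
    split; [split; [|split; [|split]]|].
    * intros t. split; [rewrite Rmult_1_l; apply Hpos|]. split; [|split].
      -- specialize (Rd t). rewrite Hw2 in Rd.
         replace (hh_f N m (sqrt (A0 + al eps)) (r0 + 1 * x eps (w * t)) (0 + eps * y eps (w * t)))
           with (1 * / (mu0 + mu eps) * accel_r N m r0 mu0 A0
             (State (x eps (w * t)) (al eps) (mu eps) (eps * y eps (w * t)))); [exact Rd|].
         unfold hh_f, accel_r; cbv [st_x st_al st_mu st_e].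
         rewrite !Rmult_1_l, !Rplus_0_l, <- Rsqr_pow2, Rsqr_sqrt by lra.
         rewrite <- Rmult_assoc, Rinv_l, Rmult_1_l by lra. reflexivity.
      -- specialize (Dd t). rewrite Hw2 in Dd.
         replace (hh_g N m (r0 + 1 * x eps (w * t)) (0 + eps * y eps (w * t)))
           with (eps * / (mu0 + mu eps) * (accel_d N m r0 mu0
             (State (x eps (w * t)) (al eps) (mu eps) (eps * y eps (w * t))) * y eps (w * t)));
           [exact Dd|].
         unfold hh_g, accel_d; cbv [st_x st_al st_mu st_e].
         rewrite !Rmult_1_l, !Rplus_0_l.
         set (Sg := sum_n_m _ _ _). field; lra.
      -- specialize (Zd t).
         match goal with |- second_derivative_at _ _ ?z => replace z with (0 * 0 ^ 2 * 0) end;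
           [exact Zd|].
         (* At height 0 the heights [d] and [- d] give equal distances, and the two pulls cancel. *)
         unfold hh_h. set (d := 0 + eps * y eps (w * t)).
         replace ((0 + 0 * 0 - d) ^ 2) with ((0 + 0 * 0 + d) ^ 2) by ring.
         unfold Rdiv; ring.
    * split; [rewrite Rmult_0_r, x_0; ring | rewrite R1, x1_0; ring].
    * split; [rewrite Rmult_0_r, y_0; ring|]. rewrite D1, y1_0. unfold w, Rdiv; ring.
    * split; [ring | rewrite Z1; ring].
    * exists (2 * PI / w). split.
      -- apply Rdiv_lt_0_compat; [|exact Hw]. pose proof PI_RGT_0; lra.
      -- intros t.
         replace (w * (t + 2 * PI / w)) with (w * t + 2 * PI) by (field; lra).
         now rewrite Hxp, Hyp.
Qed.
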